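(* Let $b>0$, let $\{\mu_n\}_{n\in\mathbb{N}^*}$ be a non-increasing sequence of positive real numbers that is regularly varying with index $-b$, and let $\phi\colon\mathbb{R}^*_+\to\mathbb{R}^*_+$ be the step function given by $\phi(t)=\mu_{\lfloor t\rfloor+1}$, for $t>0$. Let $\mathcal{E}_2$ be the $2$-ellipsoid with semi-axes $\{\mu_n\}_{n\in\mathbb{N}^*}$. Then $$\lim_{\varepsilon\to0}\frac{\varepsilon}{\phi\left(H\left(\varepsilon;\mathcal{E}_2,\|\cdot\|_2\right)\right)}=\left(\frac{b}{\ln(2)}\right)^b.$$
   Context: $\mathbb{N}^*=\{1,2,\dots\}$, $\mathbb{R}^*_+=(0,\infty)$, $\lfloor\cdot\rfloor$ is the integer part. A sequence $\{u_n\}_{n\in\mathbb{N}^*}$ of positive reals is regularly varying with index $\beta\in\mathbb{R}$ if $\lim_{n\to\infty}u_{\lfloor\alpha n\rfloor}/u_n=\alpha^\beta$ for all $\alpha>0$. $\mathcal{E}_2=\{x\in\ell^2(\mathbb{N}^*;\mathbb{R}):\sum_{n\ge1}|x_n/\mu_n|^2\le1\}$. The covering number $N(\varepsilon;\mathcal{E}_2,\|\cdot\|_2)$ is the smallest cardinality of a finite set of points of $\ell^2$ such that each $x\in\mathcal{E}_2$ is within $\ell^2$-distance at most $\varepsilon$ of one of them, and $H(\varepsilon;\mathcal{E}_2,\|\cdot\|_2)=\log N(\varepsilon;\mathcal{E}_2,\|\cdot\|_2)$ with $\log$ the logarithm to base 2; $\ln$ is the natural logarithm. *)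

(* Defs.v *)
From HB Require Import structures.
From mathcomp Require Export all_boot all_order all_algebra.
From mathcomp Require Export all_classical all_reals all_analysis.
Export Order.TTheory GRing.Theory Num.Theory.
Export numFieldNormedType.Exports.

Set Implicit Arguments.
Unset Strict Implicit.
Unset Printing Implicit Defensive.

Local Open Scope classical_set_scope.
Local Open Scope ring_scope.

(* A sequence (u_n)_{n >= 1} is given as u : nat -> R, the value u 0 being
   irrelevant (`truncn (alpha * n)` is positive for n large).  `truncn`
   is the integer part on nonnegative reals. *)
Definition regularly_varying (R : realType) (u : nat -> R) (beta : R) : Prop :=
  forall alpha : R, 0 < alpha ->
    u (Num.truncn (alpha * n%:R)) / u n @[n --> \oo] --> alpha `^ beta.

Definition phi (R : realType) (mu : nat -> R) (t : R) : R :=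
  mu (Num.truncn t).+1.

(* In contrast, an element (x_n)_{n >= 1} of R^{N^*} is
   encoded by x : nat -> R without junk value: x k is the coordinate x_{k+1}. *)
Definition norm2 (R : realType) (x : nat -> R) : \bar R :=
  ('N[(@counting nat R)]_(2%:E) [EFin \o x])%E.

Definition ell2 (R : realType) : set (nat -> R) :=
  [set x | (norm2 x < +oo)%E].

Definition ellipsoid2 (R : realType) (mu : nat -> R) : set (nat -> R) :=
  [set x | ell2 x /\
     (\sum_(0 <= k <oo) (`|x k / mu k.+1| ^+ 2)%:E <= 1)%E].

Definition has_cover (R : realType) (eps : R) (A : set (nat -> R)) (n : nat)
    : Prop :=
  exists C : set (nat -> R),
    [/\ (C #= `I_n)%card, C `<=` @ell2 R &
        forall x, A x -> exists2 c, C c & (norm2 (x \- c)%R <= eps%:E)%E].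

(* The value is 0 if no finite cover exists. *)
Definition covering_number (R : realType) (eps : R) (A : set (nat -> R)) : nat :=
  xget 0%N [set n | has_cover eps A n /\
                    forall m, has_cover eps A m -> (n <= m)%N].

Definition metric_entropy (R : realType) (eps : R) (A : set (nat -> R)) : R :=
  ln (covering_number eps A)%:R / ln 2.

(* Main.v *)
Require Import Defs.
From HB Require Import structures.
From mathcomp Require Import measurable_realfun lebesgue_integral ring lra.

Set Implicit Arguments.
Unset Strict Implicit.
Unset Printing Implicit Defensive.

Local Open Scope classical_set_scope.
Local Open Scope ring_scope.

(* Let d be the number of semi-axes larger than eps; regular variation makes the
   sum of ln (mu_n / eps) over n <= d asymptotic to b * d, and ln N turns out to be
   asymptotic to this sum.
   Lower bound: compare the volume of the section of the ellipsoid by the first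
   d coordinates with the volume of a ball of radius eps.
   Upper bound: group the coordinates into blocks on which mu is nearly constant,
   equal to M say. A block vector of energy y^2 (in units of M) is covered up to
   distortion min(1, eps / M) * M * y, i.e. proportionally to its own norm. Since
   the energies y^2 sum to at most 1, the total squared distortion is at most
   eps^2 whatever their distribution among the blocks, while the number of balls
   used, about (M / eps)^m in a block of dimension m, does not depend on it. That
   the unit ball of R^m has a cover by (1 / rho)^m * exp(o(m)) balls of radius
   rho follows by averaging: each point x of the ball is within about rho of a
   fraction about rho^m of the ball of radius sqrt (1 - rho^2), because the lens
   cut out near x contains almost all of a ball of radius rho * sqrt (1 - rho^2). *)

(** * Lebesgue measure on tuples *)

Section Volume.
Context {R : realType}.
Local Notation Rm := (measurableTypeR R).
Local Notation leb := (@lebesgue_measure R).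
Implicit Types (a b p : nat -> R).

Definition cons_pair m (p : Rm * m.-tuple Rm) : m.+1.-tuple Rm :=
  [the m.+1.-tuple Rm of p.1 :: p.2].

Lemma measurable_cons_pair m : measurable_fun setT (@cons_pair m).
Proof. exact: measurable_cons. Qed.

Definition uncons_pair m (t : m.+1.-tuple Rm) : Rm * m.-tuple Rm :=
  (thead t, [tuple of behead t]).

Lemma measurable_uncons_pair m : measurable_fun setT (@uncons_pair m).
Proof.
apply/measurable_fun_pairP; split.
  exact: (measurable_tnth ord0).
exact: measurable_behead.
Qed.

Lemma cons_pairK m : cancel (@cons_pair m) (@uncons_pair m).
Proof. by move=> [x t]; congr pair; apply/val_inj. Qed.

Section cons_measure.
Variables (m : nat) (nu : {sigma_finite_measure set (m.-tuple Rm) -> \bar R}).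

(** The product of Lebesgue measure with [nu], carried over to tuples one entry longer; its
    sigma-finiteness is proved so that the construction can be iterated. *)
Definition cons_measure : set (m.+1.-tuple Rm) -> \bar R :=
  pushforward (leb \x nu)%E (@cons_pair m).

Let cons_measure0 : cons_measure set0 = 0%E.
Proof. by rewrite /cons_measure /pushforward preimage_set0 measure0. Qed.

Let cons_measure_ge0 A : (0 <= cons_measure A)%E.
Proof. exact: (measure_ge0 (leb \x nu)%E). Qed.

Let cons_measure_sigma_additive : semi_sigma_additive cons_measure.
Proof.
move=> F mF tF mUF; rewrite /cons_measure /pushforward preimage_bigcup.
apply: measure_semi_sigma_additive.
- by move=> n; rewrite -[X in measurable X]setTI; exact: measurable_cons_pair.
- apply/trivIsetP => /= i j _ _ ij; rewrite -preimage_setI.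
  by move/trivIsetP : tF => /(_ _ _ _ _ ij) ->//; rewrite preimage_set0.
- by rewrite -preimage_bigcup -[X in measurable X]setTI; exact: measurable_cons_pair.
Qed.

HB.instance Definition _ := isMeasure.Build _ _ _ cons_measure
  cons_measure0 cons_measure_ge0 cons_measure_sigma_additive.

Let cons_measure_sigma_finite : sigma_finite setT cons_measure.
Proof.
have /sigma_finiteP[F [TF ndF Foo]] := sigma_finiteT leb.
have /sigma_finiteP[G [TG ndG Goo]] := sigma_finiteT nu.
exists (fun n => @uncons_pair m @^-1` (F n `*` G n)).
  apply/esym/seteqP; split => // t _.
  have [k _ Fk] : (\bigcup_i F i) (thead t) by rewrite -TF.
  have [l _ Gl] : (\bigcup_i G i) [tuple of behead t] by rewrite -TG.
  exists (maxn k l) => //; split => /=.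
    by move: Fk; exact/subsetPset/ndF/leq_maxl.
  by move: Gl; exact/subsetPset/ndG/leq_maxr.
move=> k; have [mF Flt] := Foo k; have [mG Glt] := Goo k; split.
  by rewrite -[X in measurable X]setTI; apply: measurable_uncons_pair => //; exact: measurableX.
rewrite /cons_measure /pushforward -comp_preimage.
rewrite (_ : _ \o _ = id); last by apply/funext => x /=; rewrite cons_pairK.
by rewrite preimage_id product_measure1E// lte_mul_pinfty// ge0_fin_numE.
Qed.

HB.instance Definition _ := Measure_isSigmaFinite.Build _ _ _ cons_measure
  cons_measure_sigma_finite.
End cons_measure.

(** Lebesgue measure on R^m; in dimension 0 the single point has mass 1. *)
Fixpoint volume m : {sigma_finite_measure set (m.-tuple Rm) -> \bar R} :=
  match m with
  | 0 => [the {sigma_finite_measure set (0.-tuple Rm) -> \bar R} of dirac ([tuple] : 0.-tuple Rm)]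
  | m'.+1 => [the {sigma_finite_measure set (m'.+1.-tuple Rm) -> \bar R} of cons_measure (volume m')]
  end.

Lemma volumeSE m (A : set (m.+1.-tuple Rm)) : measurable A ->
  volume m.+1 A = (\int[leb]_x volume m [set t | A (cons_pair (x, t))])%E.
Proof.
move=> mA.
rewrite /= /cons_measure /pushforward /product_measure1.
apply: eq_integral => x _ /=; congr (volume m _).
by apply/seteqP; split => t; rewrite /xsection/= inE.
Qed.

Lemma measurable_volume_section m (A : set (m.+1.-tuple Rm)) : measurable A ->
  @measurable_fun _ _ Rm (\bar R) setT (fun x => volume m [set t | A (cons_pair (x, t))]).
Proof.
move=> mA.
have mB : measurable (@cons_pair m @^-1` A).
  by rewrite -[X in measurable X]setTI; exact: measurable_cons_pair.
have := measurable_fun_xsection (volume m) mB.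
congr measurable_fun; apply/funext => x /=; congr (volume m _).
by apply/seteqP; split => t; rewrite /xsection/= inE.
Qed.

(** By uniqueness of Lebesgue measure: [a] times its image under the map gives half-open intervals
    their length. *)
Lemma lebesgue_measure_affine (a b : R) (A : set Rm) : 0 < a -> measurable A ->
  leb ((fun x : Rm => a * x + b : Rm) @^-1` A) = (a^-1%:E * leb A)%E.
Proof.
move=> a0 mA.
have maff : measurable_fun setT (fun x : Rm => a * x + b : Rm).
  by apply: measurable_funD => //; apply: measurable_funM.
have a0' : 0 <= a by exact: ltW.
pose f := fun x : Rm => a * x + b : Rm.
pose pf := measure_function_pushforward__canonical__measure_function_Measure leb maff.
have -> : leb A = mscale (NngNum a0') pf A.
  apply: lebesgue_measure_unique => // _ [[u v] _ <-].
  have fE : f @^-1` `]u, v] = `](u - b) / a, (v - b) / a]%classic.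
    apply/seteqP; split => x /=; rewrite !in_itv/= ltr_pdivrMr// ler_pdivlMr//;
      by rewrite ltrBlDr lerBrDr mulrC.
  change (leb `]u, v] = (a%:E * leb (f @^-1` `]u, v]))%E).
  rewrite fE.
  rewrite !lebesgue_measure_itv/= !lte_fin ltr_pM2r ?invr_gt0// ltrD2r.
  case: ifPn => _; last by rewrite mule0.
  rewrite -EFinB -EFinM -mulrBl opprB addrA subrK.
  by rewrite mulrCA divff ?gt_eqF// mulr1.
by rewrite /mscale/= muleA -EFinM mulVf ?gt_eqF// mul1e.
Qed.

Lemma ge0_integral_affine (a b : R) (f : Rm -> \bar R) : 0 < a ->
  measurable_fun setT f -> (forall x, 0 <= f x)%E ->
  (\int[leb]_x f (a * x + b)%R = a^-1%:E * \int[leb]_x f x)%E.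
Proof.
move=> a0 mf f0.
have maff : measurable_fun setT (fun x : Rm => a * x + b : Rm).
  by apply: measurable_funD => //; apply: measurable_funM.
pose g := fun x : Rm => a * x + b : Rm.
have ai0 : 0 <= a^-1 by rewrite invr_ge0 ltW.
transitivity (\int[pushforward leb g]_x f x)%E.
  by rewrite ge0_integral_pushforward.
rewrite -[in RHS](_ : (NngNum ai0)%:num = a^-1)// -ge0_integral_mscale//.
apply: eq_measure_integral => A mA _.
exact: lebesgue_measure_affine.
Qed.

Definition affine_tuple m a b (t : m.-tuple Rm) : m.-tuple Rm :=
  [tuple a i * tnth t i + b i | i < m].

Lemma measurable_affine_tuple m a b : measurable_fun setT (@affine_tuple m a b).
Proof.
apply/measurable_fun_tnthP => i.
rewrite (_ : _ \o _ = (fun t => a i * tnth t i + b i : Rm)); last first.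
  by apply/funext => t /=; rewrite tnth_mktuple.
apply: measurable_funD => //; apply: measurable_funM => //.
exact: measurable_tnth.
Qed.

(** Induction on the dimension: the sections over the first coordinate are rescaled by the induction
    hypothesis, that coordinate itself by the one-dimensional change of variable. *)
Lemma volume_affine m a b (A : set (m.-tuple Rm)) : (forall i, 0 < a i) ->
  measurable A ->
  volume m (affine_tuple a b @^-1` A) = ((\prod_(i < m) a i)^-1%:E * volume m A)%E.
Proof.
elim: m a b A => [|m IH] a b A a0 mA.
  rewrite big_ord0 invr1 mul1e; congr (volume 0 _).
  by apply/seteqP; split => t /=; rewrite (tuple0 (affine_tuple _ _ _)) (tuple0 t).
rewrite !volumeSE//; last first.
  by rewrite -[X in measurable X]setTI; exact: measurable_affine_tuple.
pose sec (x : Rm) := [set t | A (cons_pair (x, t))].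
have msec x : measurable (sec x).
  rewrite -[X in measurable X]setTI.
  apply: (measurableT_comp (@measurable_cons_pair m) (@pair1_measurable _ _ _ _ x)) => //.
transitivity (\int[leb]_x ((\prod_(i < m) a i.+1)^-1%:E *
    volume m (sec (a 0%N * x + b 0%N)%R)))%E.
  apply: eq_integral => x _.
  rewrite -(IH (fun i => a i.+1) (fun i => b i.+1))//; congr (volume m _).
  apply/seteqP; split => t /=; rewrite /sec/=;
    (suff -> : affine_tuple a b (cons_pair (x, t)) = cons_pair (a 0%N * x + b 0%N : Rm,
       affine_tuple (fun i => a i.+1) (fun i => b i.+1) t) by []);
    apply: eq_from_tnth => i; case: (unliftP ord0 i) => [j|] ->;
    rewrite !(tnthS, tnth_mktuple, tnth0)//=.
have mv := measurable_volume_section mA.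
rewrite ge0_integralZl//; first last.
- by rewrite lee_fin invr_ge0 prodr_ge0// => i _; exact/ltW.
- apply: (measurableT_comp mv) => //.
  by apply: measurable_funD => //; exact: measurable_funM.
rewrite (@ge0_integral_affine (a 0%N) (b 0%N) (fun x => volume m (sec x)))//.
by rewrite muleA -EFinM big_ord_recl/= invfM mulrC.
Qed.

(** With all [a i] equal to 1 this is the closed Euclidean ball of center [p] and radius [r]. *)
Definition ellipsoid_set m a p (r : R) : set (m.-tuple Rm) :=
  [set t | \sum_(i < m) ((tnth t i - p i) / a i) ^+ 2 <= r ^+ 2].

Lemma measurable_ellipsoid_set m a p r : measurable (@ellipsoid_set m a p r).
Proof.
have mf : measurable_fun setT ((fun t : m.-tuple Rm =>
   \sum_(i < m) ((tnth t i - p i) / a i) ^+ 2) : _ -> Rm).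
  apply: measurable_sum => i; apply: measurable_funX; apply: measurable_funM => //.
  by apply: measurable_funB => //; exact: measurable_tnth.
rewrite (_ : ellipsoid_set _ _ _ = (fun t : m.-tuple Rm =>
   \sum_(i < m) ((tnth t i - p i) / a i) ^+ 2 : Rm) @^-1` `]-oo, r ^+ 2]).
  by rewrite -[X in measurable X]setTI; exact: mf.
by apply/seteqP; split => t /=; rewrite in_itv.
Qed.

Definition cube m : set (m.-tuple Rm) := [set t | forall i, `|tnth t i| <= 1].

Lemma volume_cube m : measurable (@cube m) /\ volume m (@cube m) = (2 ^+ m)%:E.
Proof.
have mc k : measurable (@cube k).
  rewrite (_ : @cube k = \big[setI/setT]_(i < k) (fun t => tnth t i) @^-1` `[(-1 : R), 1]).
    apply: bigsetI_measurable => i _; rewrite -[X in measurable X]setTI.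
    exact: measurable_tnth.
  apply/seteqP; split => t.
    rewrite -bigcap_seq => tc i _ /=.
    by rewrite in_itv/= -ler_norml.
  rewrite -bigcap_seq => tc i; have /= := tc i (mem_index_enum _).
  by rewrite in_itv/= -ler_norml.
split => //.
elim: m => [|m IH].
  by rewrite /= diracE mem_set// => -[].
rewrite volumeSE//.
transitivity (\int[leb]_x ((\1_(`[(-1 : R), 1]%classic) x)%:E * (2 ^+ m)%:E))%E.
  apply: eq_integral => x _; rewrite -IH indicE.
  case: (boolP (x \in `[-1, 1]%classic)) => /= xi; last first.
    rewrite mul0e; rewrite -(measure0 (volume m)); congr (volume m _).
    apply/seteqP; split => t //= /(_ ord0); rewrite tnth0 => x1.
    by move/negP: xi; apply; rewrite inE/= in_itv/= -ler_norml.
  rewrite mul1e; congr (volume m _); apply/seteqP; split => t /= tc i.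
    by have := tc (lift ord0 i); rewrite tnthS.
  case: (unliftP ord0 i) => [j|] ->; first by rewrite tnthS.
  by rewrite tnth0 ler_norml; move: xi; rewrite inE/= in_itv.
rewrite ge0_integralZr//.
  rewrite integral_indic//= setIT lebesgue_measure_itv/= lte_fin.
  rewrite ifT; last by lra.
  by rewrite -EFinB -EFinM exprS; congr (_ * _)%:E; ring.
exact/measurable_EFinP/measurable_indic.
Qed.

Definition unit_ball m : set (m.-tuple Rm) := ellipsoid_set (fun=> 1) (fun=> 0) 1.

Definition ball_volume m : R := fine (volume m (@unit_ball m)).

(** The ball contains the cube of half-side 1 / (m + 1) and lies in [cube]. Positivity and
    finiteness let its volume cancel from the later comparisons. *)
Lemma volume_unit_ball m : volume m (@unit_ball m) = (ball_volume m)%:E /\ 0 < ball_volume m.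
Proof.
have mb : measurable (@unit_ball m) by exact: measurable_ellipsoid_set.
have [mc vc] := @volume_cube m.
have lo : (0 < volume m (@unit_ball m))%E.
  have c0 : 0 < m.+1%:R :> R by rewrite ltr0n.
  apply: (@lt_le_trans _ _ (volume m (affine_tuple (fun=> m.+1%:R) (fun=> 0) @^-1` @cube m))).
    rewrite volume_affine// vc -EFinM lte_fin mulr_gt0// ?exprn_gt0//.
    by rewrite invr_gt0 prodr_gt0.
  apply: (le_measure (volume m)); rewrite ?inE//.
    by rewrite -[X in measurable X]setTI; exact: measurable_affine_tuple.
  move=> t /= tc; rewrite /unit_ball /ellipsoid_set/=.
  apply: (@le_trans _ _ (\sum_(i < m) (m.+1%:R ^- 2 : R))).
    apply: ler_sum => i _; have := tc i.
    rewrite tnth_mktuple addr0 subr0 divr1 -exprVn normrM ger0_norm ?(ltW c0)// => h.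
    have h2 : `|tnth t i| <= m.+1%:R^-1 by rewrite -[leRHS]mul1r ler_pdivlMr// mulrC.
    rewrite -real_normK ?num_real//; apply: lerXn2r; rewrite ?nnegrE//.
  rewrite sumr_const card_ord expr1n -[leLHS]mulr_natl ler_pdivrMr ?exprn_gt0// mul1r.
  by rewrite -natrX ler_nat expnS expn1 (leq_trans (leqnSn m))// leq_pmulr.
have hi : (volume m (@unit_ball m) < +oo)%E.
  apply: (@le_lt_trans _ _ (volume m (@cube m))); last by rewrite vc ltry.
  apply: (le_measure (volume m)); rewrite ?inE// => t; rewrite /unit_ball /ellipsoid_set /= expr1n => tb i.
  rewrite -(@ler_pXn2r _ 2)// ?nnegrE// expr1n real_normK ?num_real//.
  apply: le_trans tb; rewrite (bigD1 i)//= subr0 divr1 lerDl.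
  by apply: sumr_ge0 => j _; exact: sqr_ge0.
have fn : volume m (@unit_ball m) \is a fin_num by rewrite ge0_fin_numE// ltW.
by rewrite /ball_volume fineK//; split => //; rewrite fine_gt0// lo hi.
Qed.

Lemma volume_ellipsoid_set m a p (r : R) : (forall i, 0 < a i) -> 0 < r ->
  volume m (ellipsoid_set a p r) = (r ^+ m * \prod_(i < m) a i * ball_volume m)%:E.
Proof.
move=> a0 r0.
rewrite (_ : ellipsoid_set a p r = affine_tuple (fun i => (r * a i)^-1) (fun i => - p i / (r * a i))
   @^-1` @unit_ball m); last first.
  apply/funext => t; rewrite /unit_ball /ellipsoid_set /= expr1n; congr is_true.
  rewrite [in RHS](_ : \sum_(i < m) _ = r ^- 2 * \sum_(i < m) ((tnth t i - p i) / a i) ^+ 2).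
    by rewrite mulrC ler_pdivrMr ?exprn_gt0// mul1r.
  rewrite mulr_sumr; apply: eq_bigr => i _; rewrite tnth_mktuple; field.
  by rewrite !gt_eqF.
rewrite volume_affine//; last exact: measurable_ellipsoid_set.
  rewrite (volume_unit_ball m).1 -EFinM; congr (_ * _)%:E.
  rewrite -prodfV; under eq_bigr do rewrite invrK.
  by rewrite big_split/= prodr_const card_ord.
by move=> i; rewrite invr_gt0 mulr_gt0.
Qed.

(** Integrate the number of sets that contain a given point. The case [k] = 1 yields packing bounds;
    in general some point lies in at least the average number of sets. *)
Lemma sum_volume_multiplicity m (I : Type) (L : seq I) (A : I -> set (m.-tuple Rm))
    (S : set (m.-tuple Rm)) (k : nat) :
  measurable S -> (forall x, measurable (A x)) -> (forall x, A x `<=` S) ->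
  (forall c, S c -> (count (fun x => c \in A x) L <= k)%N) ->
  (\sum_(x <- L) volume m (A x) <= k%:R%:E * volume m S)%E.
Proof.
move=> mS mA AS cnt.
have -> : (\sum_(x <- L) volume m (A x) =
    \int[volume m]_c \sum_(x <- L) (\1_(A x) c)%:E)%E.
  rewrite ge0_integral_sum//.
  - by apply: eq_bigr => x _; rewrite integral_indic// setIT.
  - by move=> x; exact/measurable_EFinP/measurable_indic.
have -> : (k%:R%:E * volume m S = \int[volume m]_c (k%:R%:E * (\1_S c)%:E))%E.
  rewrite ge0_integralZl//.
    by rewrite integral_indic// setIT.
  exact/measurable_EFinP/measurable_indic.
apply: ge0_le_integral => //.
- by move=> c _; apply: sume_ge0 => x _; rewrite lee_fin.
- apply: emeasurable_sum => x; exact/measurable_EFinP/measurable_indic.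
- by apply: measurable_funeM; exact/measurable_EFinP/measurable_indic.
move=> c _; rewrite sumEFin -EFinM lee_fin.
have [Sc|nSc] := pselect (S c).
  rewrite indicE mem_set// mulr1.
  apply: le_trans (_ : (count (fun x => c \in A x) L)%:R <= _); last first.
    by rewrite ler_nat; exact: cnt.
  by rewrite -sum1_count natr_sum [leRHS]big_mkcond/=; apply: ler_sum => x _;
    rewrite indicE; case: ifP.
rewrite big1 ?mulr_ge0// => x _; rewrite indicE memNset// => Ac.
exact/nSc/AS/Ac.
Qed.

End Volume.

(** * Nets of ellipsoids and economical covers of balls *)

Section BallCover.
Context {R : realType}.
Local Notation Rm := (measurableTypeR R).
Implicit Types (a : nat -> R).

Lemma pairwise_count_le1 (T : Type) (e : rel T) (P : pred T) (L : seq T) :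
  pairwise e L -> (forall x y, e x y -> P x -> P y -> False) ->
  (count P L <= 1)%N.
Proof.
move=> + eP; elim: L => [|x L IH]//= /andP[xL /IH {}IH].
case: (boolP (P x)) => Px //=; rewrite add1n ltnS leqn0 -leqn0 leqNgt -has_count.
apply/negP; move: xL; elim: L {IH} => [|y L IH]//= /andP[exy xL].
by case/orP => [|/(IH xL)//]; exact: eP exy Px.
Qed.

Definition dist2 m (t u : m.-tuple R) : R := \sum_(i < m) (tnth t i - tnth u i) ^+ 2.

Definition in_ellipsoid m a (t : m.-tuple R) : bool := \sum_(i < m) (tnth t i / a i) ^+ 2 <= 1.

Definition disk m (x : m.-tuple Rm) (r : R) : set (m.-tuple Rm) :=
  ellipsoid_set (fun=> 1) (fun i => nth 0 x i) r.

Lemma diskE m (x t : m.-tuple Rm) r : disk x r t = (dist2 t x <= r ^+ 2).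
Proof.
rewrite /disk /ellipsoid_set/= /dist2; congr (is_true (_ <= _)).
by apply: eq_bigr => i _; rewrite divr1 (tnth_nth 0 x).
Qed.

Lemma volume_disk m (x : m.-tuple Rm) r : 0 < r ->
  volume m (disk x r) = (r ^+ m * @ball_volume R m)%:E.
Proof. by move=> r0; rewrite volume_ellipsoid_set// big1 ?mulr1. Qed.

Lemma dist2_triangle m (t x y : m.-tuple R) (c : R) : 0 < c ->
  dist2 x y <= (1 + c) * dist2 x t + (1 + c^-1) * dist2 t y.
Proof.
move=> c0; rewrite /dist2 !mulr_sumr -big_split/=; apply: ler_sum => i _.
set u := tnth x i; set v := tnth t i; set w := tnth y i.
rewrite -subr_ge0.
have -> : (1 + c) * (u - v) ^+ 2 + (1 + c^-1) * (v - w) ^+ 2 - (u - w) ^+ 2 =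
  c^-1 * (c * (u - v) - (v - w)) ^+ 2.
  by field; rewrite gt_eqF.
by rewrite mulr_ge0 ?sqr_ge0// invr_ge0 ltW.
Qed.

(** Packing: the balls of radius r / 2 about the points are disjoint and, since r / 2 <= a i, lie in
    the ellipsoid with doubled semi-axes; compare volumes. *)
Lemma separated_size_le m a (r : R) (L : seq (m.-tuple R)) :
  0 < r -> (forall i, 0 < a i) -> (forall i : 'I_m, r <= 2 * a i) ->
  all (in_ellipsoid a) L -> pairwise (fun x y => r ^+ 2 < dist2 x y) L ->
  (size L)%:R <= \prod_(i < m) (4 * a i / r).
Proof.
move=> r0 a0 ra; move=> /all_nthP aL pL.
(* Points outside the ellipsoid get the empty set, as [sum_volume_multiplicity] asks for the
   inclusion in [S] at every index. *)
pose A (x : m.-tuple R) := if in_ellipsoid a x then disk (x : m.-tuple Rm) (r / 2) else set0.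
pose S := ellipsoid_set a (fun=> 0) 2 : set (m.-tuple Rm).
have r20 : 0 < r / 2 by rewrite divr_gt0.
have mA x : measurable (A x).
  by rewrite /A; case: ifP => // _; exact: measurable_ellipsoid_set.
have mS : measurable S by exact: measurable_ellipsoid_set.
have AS x : A x `<=` S.
  rewrite /A; case: ifPn => [xa|_] t; last by case.
  rewrite diskE /S /ellipsoid_set/= => tx.
  apply: (@le_trans _ _ (\sum_(i < m) (2 * (tnth x i / a i) ^+ 2 + 2 * (4 / r ^+ 2 * (tnth t i - tnth x i) ^+ 2)))).
    apply: ler_sum => i _; set u := tnth t i; set v := tnth x i.
    have : (a i)^-1 ^+ 2 <= 4 / r ^+ 2.
      have -> : 4 / r ^+ 2 = (2 / r) ^+ 2 by field; rewrite gt_eqF.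
      apply: lerXn2r; rewrite ?nnegrE ?divr_ge0 ?invr_ge0 ?(ltW r0) ?(ltW (a0 i))//.
      by rewrite ler_pdivlMr// mulrC ler_pdivrMr// ra.
    rewrite subr0 => ha.
    have : (u / a i) ^+ 2 <= 2 * (v / a i) ^+ 2 + 2 * ((a i)^-1 ^+ 2 * (u - v) ^+ 2).
      set w := (a i)^-1; have := sqr_ge0 (w * (u - 2 * v)); nra.
    by move=> /le_trans; apply; rewrite lerD2l ler_pM2l// ler_wpM2r// sqr_ge0.
  rewrite big_split/= -!mulr_sumr.
  apply: (@le_trans _ _ (2 * 1 + 2 * (4 / r ^+ 2 * (r / 2) ^+ 2))).
    by rewrite lerD ?ler_pM2l// ?divr_gt0 ?exprn_gt0.
  rewrite le_eqVlt; apply/orP; left; apply/eqP; field; by rewrite gt_eqF.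
have cnt c : S c -> (count (fun x => c \in A x) L <= 1)%N.
  move=> Sc; apply: (pairwise_count_le1 pL) => x y rxy.
  rewrite !inE /A; case: ifP => // _; case: ifP => // _; rewrite !diskE => cx cy.
  move: rxy; rewrite ltNge => /negP; apply.
  apply: le_trans (dist2_triangle c x y ltr01) _.
  have -> : dist2 x c = dist2 c x by apply: eq_bigr => i _; ring.
  rewrite invr1; move: cx cy; set u := dist2 _ _; set v := dist2 _ _.
  by rewrite !expr2; nra.
have := sum_volume_multiplicity mS mA AS cnt.
rewrite (eq_big_seq (fun=> ((r / 2) ^+ m * @ball_volume R m)%:E)); last first.
  move=> x /(nthP x)[i iL <-]; rewrite /A aL// volume_disk//.
rewrite volume_ellipsoid_set// mul1e sumEFin lee_fin big_const_seq count_predT iter_addr addr0.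
have V0 := (@volume_unit_ball R m).2.
rewrite -[leLHS]mulr_natl mulrA ler_pM2r// => h.
rewrite -(@ler_pM2r _ ((r / 2) ^+ m)) ?exprn_gt0//; apply: le_trans h _.
rewrite le_eqVlt; apply/orP; left; apply/eqP.
have cp (c : R) : c ^+ m = \prod_(i < m) c by rewrite prodr_const card_ord.
rewrite (cp 2) (cp (r / 2)) -!big_split/=.
by apply: eq_bigr => i _; field; rewrite gt_eqF.
Qed.

(** A separated family of maximal size is a net, and the packing bound ensures that a maximum
    exists. *)
Lemma ellipsoid_net m a (r : R) :
  0 < r -> (forall i, 0 < a i) -> (forall i : 'I_m, r <= 2 * a i) ->
  exists L : seq (m.-tuple R), [/\ all (in_ellipsoid a) L,
    (size L)%:R <= \prod_(i < m) (4 * a i / r) &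
    forall t : m.-tuple R, in_ellipsoid a t -> has (fun x => dist2 t x <= r ^+ 2) L].
Proof.
move=> r0 a0 ra.
pose P (L : seq (m.-tuple R)) := all (in_ellipsoid a) L && pairwise (fun x y => r ^+ 2 < dist2 x y) L.
pose Q n := `[< exists L : seq (m.-tuple R), P L /\ size L = n >].
have Q0 : exists n, Q n by exists 0%N; apply/asboolP; exists [::].
have Qb n : Q n -> (n <= Num.truncn (\prod_(i < m) (4 * a i / r)))%N.
  move=> /asboolP[L [/andP[La Lr] <-]].
  by rewrite -(@natrK R (size L)) le_truncn// (separated_size_le r0 a0 ra La Lr).
have [n /asboolP[L [/andP[La Lr] nL]] nmax] := ex_maxnP Q0 Qb.
exists L; split => //; first exact: separated_size_le.
move=> t ta; apply/negPn/negP => /hasPn nh.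
have : Q n.+1.
  apply/asboolP; exists (t :: L); rewrite /P /= ta La Lr/= nL; split => //.
  by rewrite andbT; apply/allP => x xL; rewrite ltNge nh.
by move=> /nmax; rewrite ltnn.
Qed.

(** * Lenses and economical covers of the unit ball *)

Lemma sum_sqr_linear m (w x : 'I_m -> R) (c d : R) :
  \sum_(i < m) (c * w i + d * x i) ^+ 2 = c ^+ 2 * (\sum_(i < m) w i ^+ 2)
    + 2 * c * d * (\sum_(i < m) w i * x i) + d ^+ 2 * (\sum_(i < m) x i ^+ 2).
Proof.
rewrite !mulr_sumr -!big_split/=; apply: eq_bigr => i _; ring.
Qed.

Definition zero_tuple m : m.-tuple R := [tuple 0 | i < m].
Definition scale_tuple m (c : R) (x : m.-tuple R) : m.-tuple R := [tuple c * tnth x i | i < m].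

(* A point s ^+ 2 * x + w of the disk outside the lens has |<w, x>| > del, hence
   lies in one of two caps of the disk, each contained in a disk of radius h;
   since h < rho * s, these have negligible volume in high dimension. *)
Lemma lens_cover m (x : m.-tuple R) (rho s del h S P : R) :
  0 < rho -> 0 < s -> rho ^+ 2 + s ^+ 2 = 1 -> 0 < del ->
  h ^+ 2 = (rho * s) ^+ 2 - del ^+ 2 ->
  S ^+ 2 = s ^+ 2 + 2 * del -> P ^+ 2 = rho ^+ 2 + 2 * del ->
  dist2 x (zero_tuple m) <= 1 ->
  disk (scale_tuple (s ^+ 2) x) (rho * s) `<=`
    (disk (zero_tuple m) S `&` disk x P) `|`
    (disk (scale_tuple (s ^+ 2 + del) x) h `|` disk (scale_tuple (s ^+ 2 - del) x) h).
Proof.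
move=> rho0 s0 rs d0 hE SE PE x1 t; rewrite /= !diskE.
pose w (i : 'I_m) := tnth t i - s ^+ 2 * tnth x i.
pose W := \sum_(i < m) w i ^+ 2; pose X := \sum_(i < m) tnth x i ^+ 2.
pose Y := \sum_(i < m) w i * tnth x i.
have X0 : 0 <= X by apply: sumr_ge0 => i _; exact: sqr_ge0.
have X1 : X <= 1.
  by apply: le_trans x1; apply: ler_sum => i _; rewrite tnth_mktuple subr0.
have dE c : dist2 t (scale_tuple c x) = W + 2 * (s ^+ 2 - c) * Y + (s ^+ 2 - c) ^+ 2 * X.
  have := sum_sqr_linear w (tnth x) 1 (s ^+ 2 - c).
  rewrite expr1n mul1r mulr1 => <-; apply: eq_bigr => i _.
  by rewrite tnth_mktuple /w; congr (_ ^+ 2); ring.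
have d0E : dist2 t (zero_tuple m) = W + 2 * s ^+ 2 * Y + s ^+ 2 ^+ 2 * X.
  have := dE 0; rewrite subr0 => <-; apply: eq_bigr => i _.
  by rewrite !tnth_mktuple mul0r.
have d1E : dist2 t x = W + 2 * (s ^+ 2 - 1) * Y + (s ^+ 2 - 1) ^+ 2 * X.
  by rewrite -dE; apply: eq_bigr => i _; rewrite !tnth_mktuple mul1r.
rewrite !dE d0E d1E SE PE hE subrr mulr0 mul0r addr0 expr0n/= mul0r addr0 => Wr.
have s2 : 0 < s ^+ 2 by rewrite exprn_gt0.
have r2 : 0 < rho ^+ 2 by rewrite exprn_gt0.
move: Wr; rewrite !exprMn.
have -> : rho ^+ 2 = 1 - s ^+ 2 by rewrite -rs; ring.
move: r2; have -> : rho ^+ 2 = 1 - s ^+ 2 by rewrite -rs; ring.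
move: (s ^+ 2) s2 => q q0 q1 Wr.
(* If Y > del, moving the center by del * x lowers the squared distance by 2 * del * Y - del ^ 2 *
   X, which is at least del ^ 2; the case Y < - del is symmetric. Otherwise the cross term adds at
   most 2 * del to the squared distances to 0 and to x. *)
have [Yd|Yd] := ltP del Y.
  by right; left; nra.
have [Yd'|Yd'] := ltP Y (- del).
  by right; right; nra.
left; split.
  have : q ^+ 2 * X <= q ^+ 2 by rewrite ler_piMr ?sqr_ge0.
  have : q * Y <= q * del by rewrite ler_pM2l.
  have : q * del <= del by nra.
  nra.
have : (q - 1) ^+ 2 * X <= (q - 1) ^+ 2 by rewrite ler_piMr ?sqr_ge0.
have : (q - 1) * Y <= (1 - q) * del by nra.
have : (1 - q) * del <= del by nra.
nra.
Qed.

(** By [lens_cover] the lens and two balls of radius [h] cover a ball of radius rho * s. Each of the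
    two has at most a quarter of its volume, so half is left for the lens. *)
Lemma lens_volume m (x : m.-tuple R) (rho s del h S P : R) :
  0 < rho -> 0 < s -> rho ^+ 2 + s ^+ 2 = 1 -> 0 < del ->
  0 < h -> h ^+ 2 = (rho * s) ^+ 2 - del ^+ 2 ->
  0 < S -> S ^+ 2 = s ^+ 2 + 2 * del -> P ^+ 2 = rho ^+ 2 + 2 * del ->
  dist2 x (zero_tuple m) <= 1 -> 4 * h ^+ m <= (rho * s) ^+ m ->
  (((rho * s / S) ^+ m / 2)%:E * volume m (disk (zero_tuple m : m.-tuple Rm) S) <=
   volume m (disk (zero_tuple m : m.-tuple Rm) S `&` disk (x : m.-tuple Rm) P))%E.
Proof.
move=> rho0 s0 rs d0 h0 hE S0 SE PE x1 hm.
have mt (y : m.-tuple Rm) r : measurable (disk y r) by exact: measurable_ellipsoid_set.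
have sub := lens_cover rho0 s0 rs d0 hE SE PE x1.
have V0 := (@volume_unit_ball R m).2.
have rs0 : 0 < rho * s by rewrite mulr_gt0.
set A := _ `&` _ in sub *.
have mA : measurable A by exact: measurableI.
have : (volume m (disk (scale_tuple (s ^+ 2) x : m.-tuple Rm) (rho * s)) <=
  volume m A + (volume m (disk (scale_tuple (s ^+ 2 + del) x : m.-tuple Rm) h) +
  volume m (disk (scale_tuple (s ^+ 2 - del) x : m.-tuple Rm) h)))%E.
  apply: le_trans (le_measure (volume m) _ _ sub) _; rewrite ?inE//.
    by apply: measurableU => //; exact: measurableU.
  apply: le_trans (measureU2 _ _ _) _ => //; first exact: measurableU.
  by rewrite leeD2l// measureU2.
rewrite !volume_disk// -EFinD => hv.
have Afin : (volume m A \is a fin_num)%E.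
  rewrite ge0_fin_numE//; apply: (@le_lt_trans _ _ (volume m (disk (zero_tuple m : m.-tuple Rm) S))).
    by apply: (le_measure (volume m)); rewrite ?inE//; exact: subIsetl.
  by rewrite volume_disk// ltry.
move: hv; rewrite -(fineK Afin) -EFinD -EFinM !lee_fin => hv.
have -> : (rho * s / S) ^+ m / 2 * (S ^+ m * ball_volume m) = (rho * s) ^+ m * @ball_volume R m / 2.
  by rewrite expr_div_n; field; rewrite expf_neq0// gt_eqF.
move: hv hm V0; set v := ball_volume m; set u := (rho * s) ^+ m; set g := h ^+ m.
by nra.
Qed.

(** Each choice covers at least a fraction [p] of what remains, so after [k] choices fewer than one
    point, hence none, is left. *)
Lemma greedy_cover (T C : Type) (good : pred T) (cov : C -> T -> bool) (p : R) :
  0 <= p -> p <= 1 ->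
  (forall L : seq T, all good L -> exists c, p * (size L)%:R <= (count (cov c) L)%:R) ->
  forall k (L : seq T), all good L -> (1 - p) ^+ k * (size L)%:R < 1 ->
  exists2 Cs : seq C, (size Cs <= k)%N & all (fun x => has (fun c => cov c x) Cs) L.
Proof.
move=> p0 p1 H; elim=> [|k IH] L gL.
  rewrite mul1r (_ : 1 = 1%:R)// ltr_nat ltnS leqn0 => /nilP ->.
  by exists [::].
move=> hk; have [c hc] := H L gL.
have gF : all good [seq x <- L | ~~ cov c x].
  by rewrite all_filter; apply: sub_all gL => x gx /=; rewrite gx implybT.
have [|Cs sC aC] := IH _ gF.
  apply: le_lt_trans hk; rewrite exprSr -mulrA ler_wpM2l ?exprn_ge0 ?subr_ge0//.
  rewrite size_filter -(count_predC (cov c) L) natrD; move: hc.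
  by rewrite -(count_predC (cov c) L) natrD; lra.
exists (c :: Cs); first by rewrite /= ltnS.
elim: L aC {hk hc gF gL} => //= x L IHL.
by case: (cov c x) => /= [/IHL//|/andP[-> /IHL]].
Qed.

(** Averaging: each lens fills a fixed fraction of the ball of radius [S], so the point of that ball
    lying in the most lenses lies in at least that fraction of them. *)
Lemma exists_good_center m (rho s del h S P : R) (L : seq (m.-tuple R)) :
  0 < rho -> 0 < s -> rho ^+ 2 + s ^+ 2 = 1 -> 0 < del ->
  0 < h -> h ^+ 2 = (rho * s) ^+ 2 - del ^+ 2 ->
  0 < S -> S ^+ 2 = s ^+ 2 + 2 * del -> P ^+ 2 = rho ^+ 2 + 2 * del ->
  4 * h ^+ m <= (rho * s) ^+ m ->
  all (fun x => dist2 x (zero_tuple m) <= 1) L ->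
  exists c : m.-tuple R, (rho * s / S) ^+ m / 2 * (size L)%:R <=
    (count (fun x => dist2 c x <= P ^+ 2) L)%:R.
Proof.
move=> rho0 s0 rs d0 h0 hE S0 SE PE hm aL.
pose B : set (m.-tuple Rm) := disk (zero_tuple m) S.
pose A (x : m.-tuple R) : set (m.-tuple Rm) := B `&` disk x P.
have mB : measurable B by exact: measurable_ellipsoid_set.
have mA x : measurable (A x) by apply: measurableI => //; exact: measurable_ellipsoid_set.
have AB x : A x `<=` B by exact: subIsetl.
pose Q n := `[< exists2 c, B c & count (fun x => c \in A x) L = n >].
have Qex : exists n, Q n.
  exists (count (fun x => (zero_tuple m : m.-tuple Rm) \in A x) L); apply/asboolP; exists (zero_tuple m) => //.
  rewrite /B diskE /dist2 big1 ?sqr_ge0// => i _; rewrite subrr expr0n//.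
have Qb n : Q n -> (n <= size L)%N by move=> /asboolP[c _ <-]; exact: count_size.
have [n /asboolP[c Bc cn] nmax] := ex_maxnP Qex Qb.
exists c.
have cnt c' : B c' -> (count (fun x => c' \in A x) L <= n)%N.
  by move=> Bc'; apply: nmax; apply/asboolP; exists c'.
apply: (@le_trans _ _ n%:R); last first.
  rewrite ler_nat -cn; apply: sub_count => x; rewrite inE => -[_].
  by rewrite diskE.
have := sum_volume_multiplicity mB mA AB cnt.
have V0 := (@volume_unit_ball R m).2.
have vB : volume m B = (S ^+ m * @ball_volume R m)%:E by rewrite volume_disk.
have vB0 : 0 < S ^+ m * @ball_volume R m by rewrite mulr_gt0// exprn_gt0.
move=> hle.
have : ((size L)%:R%:E * (((rho * s / S) ^+ m / 2)%:E * volume m B) <= n%:R%:E * volume m B)%E.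
  apply: le_trans hle.
  elim: L aL {Q Qex Qb nmax cnt cn} => [|x L IH] /= => [_|/andP[xg /IH aL]].
    by rewrite big_nil mul0e.
  rewrite big_cons -natr1 addrC EFinD muleDl//; last by rewrite vB.
  by rewrite mul1e leeD// (lens_volume rho0 s0 rs d0 h0 hE S0 SE PE xg hm).
by rewrite vB -!EFinM lee_fin mulrA ler_pM2r// mulrC.
Qed.

(** With u = ln a, a ^ m = exp (m * u / 2) ^ 2 >= (1 + m * u / 2) ^ 2, whose quadratic term exceeds
    C * m once m >= 4 * |C| / u ^ 2. *)
Lemma linear_le_geometric (a C : R) : 1 < a ->
  exists m0 : nat, forall m, (m0 <= m)%N -> C * m%:R + 1 <= a ^+ m.
Proof.
move=> a1; have a0 : 0 < a by apply: lt_trans a1.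
pose u := ln a; have u0 : 0 < u by rewrite ln_gt0.
pose B := `|C| * 4 / u ^+ 2.
exists (Num.truncn B).+1 => m mB.
have hB : B <= m%:R.
  by apply/ltW/(lt_le_trans (truncnS_gt B)); rewrite ler_nat.
have hC : C <= m%:R * u ^+ 2 / 4.
  apply: le_trans (ler_norm C) _; rewrite ler_pdivlMr//.
  by rewrite -ler_pdivrMr ?exprn_gt0.
have -> : a ^+ m = expR (m%:R * u / 2) ^+ 2.
  rewrite -expRM_natl (_ : 2%:R * _ = m%:R * u); last by field.
  by rewrite expRM_natl lnK.
have m0 : 0 <= m%:R :> R by [].
have h1 : 1 + m%:R * u / 2 <= expR (m%:R * u / 2) by exact: expR_ge1Dx.
have h0 : 0 <= m%:R * u / 2 by rewrite divr_ge0// mulr_ge0// ltW.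
apply: le_trans (_ : (1 + m%:R * u / 2) ^+ 2 <= _); last first.
  by apply: lerXn2r => //; rewrite nnegrE ?expR_ge0// addr_ge0.
have : C * m%:R <= m%:R * u ^+ 2 / 4 * m%:R by rewrite ler_wpM2r.
move: h0; set w := m%:R; nra.
Qed.

(** A fine net of the ball is covered greedily by balls of radius [P], slightly below [rho], and the
    mesh takes up the difference. The net has exponential size, but only its logarithm enters the
    count. *)
Lemma ball_cover (rho eta : R) : 0 < rho -> rho < 1 -> 0 < eta ->
  exists m0 : nat, forall m, (m0 <= m)%N ->
  exists Cs : seq (m.-tuple R), (size Cs)%:R <= expR (m%:R * (eta - ln rho)) /\
    forall x : m.-tuple R, dist2 x (zero_tuple m) <= 1 ->
      has (fun c => dist2 x c <= rho ^+ 2) Cs.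
Proof.
move=> rho0 rho1 eta0.
(* Shrinking rho costs a factor g ^+ 2 per dimension, enlarging the radii a
   factor g, and the size of the net at most g ^+ 3: in all g ^+ 6 <= exp eta. *)
pose g : R := Num.min (expR (eta / 6)) (3 / 2).
have g1 : 1 < g by rewrite lt_min -[X in X < _]expR0 ltr_expR divr_gt0//=; lra.
have g2 : g <= 3 / 2 by rewrite ge_min lexx orbT.
have g0 : 0 < g by lra.
have g6 : g ^+ 6 <= expR eta.
  rewrite (_ : eta = 6%:R * (eta / 6)); last by field.
  rewrite expRM_natl; apply: lerXn2r; rewrite ?nnegrE ?expR_ge0 ?(ltW g0)//.
  by rewrite ge_min lexx.
(* One factor [g] pays for P <= g * rho', the other for the mesh [kap] of the net: kap + P = g * P
   <= rho. *)
pose rho' := rho / g ^+ 2.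
have rho'0 : 0 < rho' by rewrite divr_gt0// exprn_gt0.
have rho'1 : rho' < 1.
  by rewrite ltr_pdivrMr ?exprn_gt0// mul1r (lt_trans rho1)// exprn_egt1.
pose s := Num.sqrt (1 - rho' ^+ 2).
have s20 : 0 < 1 - rho' ^+ 2 by rewrite subr_gt0 exprn_ilt1// ltW.
have s0 : 0 < s by rewrite sqrtr_gt0.
have sE : s ^+ 2 = 1 - rho' ^+ 2 by rewrite sqr_sqrtr// ltW.
have s1 : s ^+ 2 <= 1 by rewrite sE gerBl sqr_ge0.
pose r := rho' * s.
have r0 : 0 < r by rewrite mulr_gt0.
have r2E : r ^+ 2 = rho' ^+ 2 * s ^+ 2 by rewrite /r exprMn.
have r2 : r ^+ 2 <= rho' ^+ 2 by rewrite r2E ler_piMr// sqr_ge0.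
have r1 : r < 1.
  by rewrite -(@ltr_pXn2r _ 2)// ?nnegrE ?ltW// expr1n (le_lt_trans r2)// exprn_ilt1// ltW.
(* Chosen so that 2 * del = (g ^ 2 - 1) * r ^ 2; as r <= rho' and r <= s, this gives P <= g * rho'
   and S <= g * s. *)
pose del := (g ^+ 2 - 1) / 2 * r ^+ 2.
have gg : 0 < g ^+ 2 - 1 by rewrite subr_gt0 exprn_egt1.
have del0 : 0 < del by rewrite mulr_gt0 ?divr_gt0// exprn_gt0.
have delr : del < r.
  rewrite /del; have : g ^+ 2 <= 9 / 4 by rewrite expr2; nra.
  by move=> ?; rewrite expr2; nra.
have h20 : 0 < r ^+ 2 - del ^+ 2 by rewrite subr_gt0 ltrXn2r ?nnegrE ?ltW.
pose h := Num.sqrt (r ^+ 2 - del ^+ 2).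
have h0 : 0 < h by rewrite sqrtr_gt0.
have hE : h ^+ 2 = (rho' * s) ^+ 2 - del ^+ 2 by rewrite sqr_sqrtr// ltW.
have hr : h < r.
  rewrite -(@ltr_pXn2r _ 2)// ?nnegrE ?ltW//.
  by rewrite hE -/r ltrBlDr ltrDl exprn_gt0.
pose S := Num.sqrt (s ^+ 2 + 2 * del).
have S20 : 0 < s ^+ 2 + 2 * del by rewrite addr_gt0 ?exprn_gt0// mulr_gt0.
have S0 : 0 < S by rewrite sqrtr_gt0.
have SE : S ^+ 2 = s ^+ 2 + 2 * del by rewrite sqr_sqrtr// ltW.
pose P := Num.sqrt (rho' ^+ 2 + 2 * del).
have P20 : 0 < rho' ^+ 2 + 2 * del by rewrite addr_gt0 ?exprn_gt0// mulr_gt0.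
have P0 : 0 < P by rewrite sqrtr_gt0.
have PE : P ^+ 2 = rho' ^+ 2 + 2 * del by rewrite sqr_sqrtr// ltW.
have delE : 2 * del = (g ^+ 2 - 1) * r ^+ 2 by rewrite /del; field.
have grho0 : 0 < g * rho' by apply: mulr_gt0.
have Pg : P <= g * rho'.
  rewrite -(@ler_pXn2r _ 2)// ?nnegrE ?(ltW grho0) ?(ltW P0)// PE delE [(g * _) ^+ 2]exprMn.
  by have := ler_wpM2l (ltW gg) r2; lra.
have Sg : S <= g * s.
  rewrite -(@ler_pXn2r _ 2)// ?nnegrE ?mulr_ge0 ?(ltW s0) ?(ltW g0) ?(ltW S0)// SE delE [(g * _) ^+ 2]exprMn.
  have : r ^+ 2 <= s ^+ 2 by rewrite r2E ler_piMl ?sqr_ge0// exprn_ile1// ltW.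
  by move/(ler_wpM2l (ltW gg)); lra.
have rS : rho / g ^+ 3 <= r / S.
  rewrite ler_pdivlMr//; apply: le_trans (_ : rho / g ^+ 3 * (g * s) <= _).
    by rewrite ler_pM2l// divr_gt0// exprn_gt0.
  rewrite /r /rho' le_eqVlt; apply/orP; left; apply/eqP; field.
  by rewrite gt_eqF.
have rS0 : 0 < r / S by rewrite divr_gt0.
have rS1 : r / S <= 1.
  rewrite ler_pdivrMr// mul1r -(@ler_pXn2r _ 2)// ?nnegrE ?(ltW r0) ?(ltW S0)//.
  have : r ^+ 2 <= s ^+ 2 by rewrite r2E ler_piMl ?sqr_ge0// exprn_ile1// ltW.
  by rewrite SE; lra.
pose tau := g - 1; have tau0 : 0 < tau by rewrite subr_gt0.
pose kap := tau * P; have kap0 : 0 < kap by rewrite mulr_gt0.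
have P32 : P <= 3 / 2 by nra.
have kap2 : kap <= 2 by rewrite /kap /tau; nra.
pose c := ln (4 / kap).
have c0 : 0 <= c by rewrite ln_ge0// ler_pdivlMr//; lra.
(* From [m1] on, the logarithm of the size of the net is absorbed; from [m2] on, each cap has at
   most a quarter of the volume of the disk. *)
have [m1 Hm1] : exists m0 : nat, forall m, (m0 <= m)%N -> 2 * c * m%:R + 1 <= (g ^+ 3) ^+ m.
  by apply: linear_le_geometric; rewrite exprn_egt1.
have [m2 Hm2] : exists m0 : nat, forall m, (m0 <= m)%N -> 3 * m%:R + 1 <= (r / h) ^+ m.
  by apply: linear_le_geometric; rewrite ltr_pdivlMr// mul1r.
exists (maxn (maxn m1 m2) 1) => m; rewrite !geq_max -andbA => /and3P[/Hm1 {}Hm1 /Hm2 {}Hm2 m_ge1].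
have hm : 4 * h ^+ m <= r ^+ m.
  rewrite -ler_pdivlMr ?exprn_gt0// -expr_div_n; apply: le_trans Hm2.
  have : 1 <= m%:R :> R by rewrite ler1n.
  by lra.
have kap21 : kap <= 2 * 1 by rewrite mulr1.
have [L [Lball Lsize Lnet]] := @ellipsoid_net m (fun=> 1) kap kap0 (fun=> ltr01)
  (fun=> kap21).
have ball01 (x : m.-tuple R) : in_ellipsoid (fun=> 1) x = (dist2 x (zero_tuple m) <= 1).
  by congr (_ <= _); apply: eq_bigr => i _; rewrite tnth_mktuple subr0 divr1.
have {}Lball : all (fun x => dist2 x (zero_tuple m) <= 1) L.
  by apply: sub_all Lball => x; rewrite ball01.
have {}Lsize : (size L)%:R <= expR (m%:R * c).
  apply: le_trans Lsize _; rewrite prodr_const card_ord mulr1 expRM_natl lnK//.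
  by rewrite posrE divr_gt0.
pose p := (r / S) ^+ m / 2.
have p0 : 0 < p by rewrite divr_gt0// exprn_gt0.
have p1 : p <= 1.
  rewrite ler_pdivrMr// mul1r; apply: (@le_trans _ _ 1); last by lra.
  by rewrite exprn_ile1// ltW.
(* Since 1 - p <= exp (- p) and the net has at most exp (m * c) points, p * k > m * c choices
   exhaust it. *)
pose k := (Num.truncn (m%:R * c / p)).+1.
have kE : m%:R * c < p * k%:R.
  by rewrite [ltRHS]mulrC -ltr_pdivrMr// truncnS_gt.
have [] := @greedy_cover _ _ (fun x : m.-tuple R => dist2 x (zero_tuple m) <= 1)
  (fun (c : m.-tuple R) x => dist2 c x <= P ^+ 2) p (ltW p0) p1 _ k L Lball.
- move=> L' aL'.
  apply: (exists_good_center rho'0 s0 _ del0 h0 hE S0 SE PE hm aL').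
  by rewrite sE addrC subrK.
- apply: (@le_lt_trans _ _ (expR (- p) ^+ k * expR (m%:R * c))).
    apply: ler_pM => //; first by rewrite exprn_ge0// subr_ge0.
    apply: lerXn2r; rewrite ?nnegrE ?expR_ge0 ?subr_ge0//.
    by have := expR_ge1Dx (- p).
  by rewrite -expRM_natl -expRD -[X in _ < X]expR0 ltr_expR; lra.
move=> Cs sC /allP aC; exists Cs; split.
  apply: (@le_trans _ _ ((2 * c * m%:R + 1) * (r / S)^-1 ^+ m)).
    apply: (@le_trans _ _ k%:R); first by rewrite ler_nat.
    rewrite /k -natr1 mulrDl mul1r lerD//.
      have k0 : 0 <= m%:R * c / p by rewrite !mulr_ge0 ?invr_ge0 ?(ltW p0).
      have /andP[k1 _] := truncn_itv k0; apply: le_trans k1 _.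
      rewrite /p le_eqVlt exprVn; apply/orP; left; apply/eqP; field.
      by rewrite expf_neq0//= gt_eqF.
    by rewrite exprVn -[leLHS]invr1 lef_pV2 ?posrE ?exprn_gt0// exprn_ile1// ltW.
  apply: (@le_trans _ _ ((g ^+ 3) ^+ m * (g ^+ 3 / rho) ^+ m)).
    apply: ler_pM => //.
    - by rewrite addr_ge0// !mulr_ge0.
    - by rewrite exprn_ge0// invr_ge0 ltW.
    apply: lerXn2r; rewrite ?nnegrE ?invr_ge0 ?(ltW rS0) ?divr_ge0 ?exprn_ge0 ?(ltW g0) ?(ltW rho0)//.
    rewrite -[leRHS]invrK lef_pV2 ?posrE ?invr_gt0 ?divr_gt0 ?exprn_gt0//.
    by rewrite invf_div.
  rewrite -exprMn expRM_natl; apply: lerXn2r; rewrite ?nnegrE ?expR_ge0//.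
    by rewrite mulr_ge0 ?divr_ge0 ?exprn_ge0 ?ltW.
  rewrite expRD expRN lnK ?posrE// mulrA -exprD ler_pM2r ?invr_gt0//.
move=> x x1.
have /hasP[y yL xy] : has (fun y => dist2 x y <= kap ^+ 2) L by apply: Lnet; rewrite ball01.
have /hasP[d dC dy] := aC _ yL.
apply/hasP; exists d => //.
(* The weight 1 / tau is the ratio of the distances [P] and [kap], so that the bound is exactly (kap
   + P) ^ 2 = (g * P) ^ 2. *)
have ti0 : 0 < tau^-1 by rewrite invr_gt0.
apply: le_trans (dist2_triangle y x d ti0) _; rewrite invrK.
have -> : dist2 y d = dist2 d y by apply: eq_bigr => i _; ring.
apply: (@le_trans _ _ ((1 + tau^-1) * kap ^+ 2 + (1 + tau) * P ^+ 2)).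
  by rewrite lerD// ler_pM2l// addr_gt0.
have -> : (1 + tau^-1) * kap ^+ 2 + (1 + tau) * P ^+ 2 = (g * P) ^+ 2.
  by rewrite /kap /tau; field; rewrite subr_eq0 gt_eqF.
apply: lerXn2r; rewrite ?nnegrE ?mulr_ge0 ?(ltW g0) ?(ltW rho0) ?(ltW P0)//.
apply: le_trans (_ : g * (g * rho') <= _); first by rewrite ler_pM2l.
rewrite /rho' le_eqVlt; apply/orP; left; apply/eqP; field.
by rewrite gt_eqF.
Qed.

End BallCover.

(** * Codes for intervals of coordinates *)

Section Codes.
Context {R : realType}.
Implicit Types (w x : nat -> R).

(* Up to the slack a, the distortion budget is proportional to the energy
   \sum_i w i * x i ^+ 2 of the coded point, so that the budgets of consecutive
   intervals of coordinates add up. *)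
Definition code w (eps2 : R) (s e : nat) (a h : R) : Prop :=
  exists (T : finType) (c : T -> nat -> R), #|T|%:R <= expR h /\
    forall x, \sum_(s <= i < e) w i * x i ^+ 2 <= 1 ->
    exists k, \sum_(s <= i < e) (x i - c k i) ^+ 2 <=
      eps2 * \sum_(s <= i < e) w i * x i ^+ 2 + a.

Lemma code_empty w eps2 s : code w eps2 s s 0 0.
Proof.
exists unit, (fun _ _ => 0); split; first by rewrite card_unit expR0.
by move=> x _; exists tt; rewrite !big_geq// mulr0 addr0.
Qed.

Lemma code_concat w eps2 s m e a a' h h' :
  (forall i, 0 <= w i) -> (s <= m)%N -> (m <= e)%N ->
  code w eps2 s m a h -> code w eps2 m e a' h' -> code w eps2 s e (a + a') (h + h').
Proof.
move=> w0 sm me [T [c [cT cP]]] [T' [c' [cT' cP']]].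
exists (T * T')%type, (fun k i => if (i < m)%N then c k.1 i else c' k.2 i); split.
  by rewrite card_prod natrM expRD ler_pM.
move=> x; have wx0 i : 0 <= w i * x i ^+ 2 by rewrite mulr_ge0// sqr_ge0.
rewrite !(big_cat_nat sm me)/= => wx1.
have [|k hk] := cP x; first by apply: le_trans wx1; rewrite lerDl sumr_ge0.
have [|k' hk'] := cP' x; first by apply: le_trans wx1; rewrite lerDr sumr_ge0.
exists (k, k'); rewrite /= !(big_cat_nat sm me)/=.
have -> : \sum_(s <= i < m) (x i - if (i < m)%N then c k i else c' k' i) ^+ 2 =
    \sum_(s <= i < m) (x i - c k i) ^+ 2.
  by apply: eq_big_nat => i /andP[_ im]; rewrite im.
have -> : \sum_(m <= i < e) (x i - if (i < m)%N then c k i else c' k' i) ^+ 2 =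
    \sum_(m <= i < e) (x i - c' k' i) ^+ 2.
  by apply: eq_big_nat => i /andP[im _]; rewrite ltnNge im.
by rewrite mulrDr; lra.
Qed.

Lemma sum_shift (F : nat -> R) s e : \sum_(s <= i < e) F i = \sum_(i < e - s) F (s + i)%N.
Proof. by rewrite -[s]add0n big_addn big_mkord add0n; apply: eq_bigr => i _; rewrite addnC. Qed.

(** On the block the energy dominates |x / M| ^ 2. The ball cover is scaled to one of K + 1 radii,
    the square of which overshoots |x / M| ^ 2 by at most 1 / K; the error scales along, and the
    choice of radius costs ln (K + 1). *)
Lemma code_block (rho eta : R) (K : nat) : 0 < rho -> rho < 1 -> 0 < eta -> (0 < K)%N ->
  exists m0 : nat, forall w (eps2 M : R) s e, (s + m0 <= e)%N -> 0 < M ->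
    (forall i, (s <= i)%N -> (i < e)%N -> M ^- 2 <= w i) -> M ^+ 2 * rho ^+ 2 <= eps2 ->
    code w eps2 s e (eps2 / K%:R) (ln K.+1%:R + (e - s)%N%:R * (eta - ln rho)).
Proof.
move=> rho0 rho1 eta0 K0; have [m0 Hm0] := ball_cover rho0 rho1 eta0.
exists m0 => w eps2 M s e se M0 wM Meps.
have [|Cs [sC cC]] := Hm0 (e - s)%N; first by rewrite leq_subRL// (leq_trans (leq_addr m0 s)).
have K0' : 0 < K%:R :> R by rewrite ltr0n.
(* The energy of the point is rounded up to a multiple of 1 / K. *)
pose u (j : nat) : R := Num.sqrt (j.+1%:R / K%:R).
have u2 j : u j ^+ 2 = j.+1%:R / K%:R by rewrite sqr_sqrtr// divr_ge0.
have u0 j : 0 < u j by rewrite sqrtr_gt0 divr_gt0.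
pose c (k : 'I_K.+1 * 'I_(size Cs)) (i : nat) : R :=
  M * u k.1 * nth 0 (nth (zero_tuple (e - s)) Cs k.2) (i - s).
exists ('I_K.+1 * 'I_(size Cs))%type, c; split.
  rewrite card_prod !card_ord natrM expRD lnK ?posrE// ler_pM2l//.
move=> x wx1.
pose y2 := \sum_(s <= i < e) M ^- 2 * x i ^+ 2.
have y20 : 0 <= y2.
  by apply: sumr_ge0 => i _; rewrite mulr_ge0 ?sqr_ge0// invr_ge0 exprn_ge0// ltW.
have y2w : y2 <= \sum_(s <= i < e) w i * x i ^+ 2.
  by apply: ler_sum_nat => i /andP[si ie]; rewrite ler_wpM2r ?sqr_ge0// wM.
have y21 : y2 <= 1 by exact: le_trans wx1.
pose j := Num.truncn (K%:R * y2).
have Ky0 : 0 <= K%:R * y2 by rewrite mulr_ge0.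
have jK : (j < K.+1)%N.
  rewrite ltnS /j -[leqRHS](@natrK R) le_truncn// ler_piMr//.
have jy : j%:R <= K%:R * y2 by rewrite truncn_le.
have yj : y2 <= u j ^+ 2.
  by rewrite u2 ler_pdivlMr// mulrC ltW// truncnS_gt.
pose t : (e - s).-tuple R := [tuple x (s + i)%N / (M * u j) | i < e - s].
have Mu0 : 0 < M * u j by rewrite mulr_gt0.
have dt : dist2 t (zero_tuple (e - s)) = y2 / u j ^+ 2.
  rewrite /y2 sum_shift mulr_suml; apply: eq_bigr => i _; rewrite !tnth_mktuple.
  by field; rewrite !gt_eqF.
have /cC/hasP[z zC dz] : dist2 t (zero_tuple (e - s)) <= 1.
  by rewrite dt ler_pdivrMr ?mul1r// exprn_gt0.
have zi : (index z Cs < size Cs)%N by rewrite index_mem.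
exists (Ordinal jK, Ordinal zi).
have -> : \sum_(s <= i < e) (x i - c (Ordinal jK, Ordinal zi) i) ^+ 2 =
    (M * u j) ^+ 2 * dist2 t z.
  rewrite sum_shift /dist2 mulr_sumr; apply: eq_bigr => i _.
  rewrite /c/= nth_index// addKn tnth_mktuple (tnth_nth 0) -exprMn mulrBr.
  by congr ((_ - _) ^+ 2); rewrite mulrCA divff ?mulr1// gt_eqF.
apply: (@le_trans _ _ ((M ^+ 2 * rho ^+ 2) * u j ^+ 2)).
  rewrite (_ : _ * u j ^+ 2 = (M * u j) ^+ 2 * rho ^+ 2); last by ring.
  by rewrite ler_pM2l ?exprn_gt0.
have eps20 : 0 <= eps2.
  by apply: le_trans Meps; rewrite mulr_ge0 ?exprn_ge0// ltW.
apply: (@le_trans _ _ (eps2 * u j ^+ 2)); first by rewrite ler_wpM2r// exprn_ge0// ltW.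
rewrite -mulrDr ler_wpM2l// u2 -natr1 mulrDl mul1r lerD2r.
by apply: le_trans y2w; rewrite ler_pdivrMr// mulrC.
Qed.

(** For the first coordinates, where the semi-axes may vary widely, a plain net is enough; its error
    is charged entirely to the slack. *)
Lemma code_head (a : nat -> R) (m : nat) (eps2 r h : R) :
  0 < r -> (forall i, 0 < a i) -> (forall i : 'I_m, r <= 2 * a i) -> 0 <= eps2 ->
  \prod_(i < m) (4 * a i / r) <= expR h ->
  code (fun i => a i ^- 2) eps2 0 m (r ^+ 2) h.
Proof.
move=> r0 a0 ra e0 hp; have [L [_ sL Lnet]] := ellipsoid_net r0 a0 ra.
exists ('I_(size L)), (fun (k : 'I_(size L)) i => nth 0 (nth (zero_tuple m) L k) i); split.
  by rewrite card_ord; exact: le_trans hp.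
move=> x; rewrite big_mkord => wx.
pose t : m.-tuple R := [tuple x i | i < m].
have /Lnet/hasP[z zL tz] : in_ellipsoid a t.
  rewrite /in_ellipsoid; apply: le_trans wx; apply: ler_sum => i _.
  by rewrite tnth_mktuple exprMn exprVn mulrC.
have zi : (index z L < size L)%N by rewrite index_mem.
exists (Ordinal zi); rewrite /= nth_index//.
apply: (@le_trans _ _ (r ^+ 2)).
  rewrite big_mkord; apply: le_trans tz; apply: ler_sum => i _.
  by rewrite tnth_mktuple (tnth_nth 0).
rewrite lerDr mulr_ge0//; apply: sumr_ge0 => i _.
by rewrite mulr_ge0 ?sqr_ge0// invr_ge0 exprn_ge0// ltW.
Qed.

Lemma code_weaken (w : nat -> R) eps2 s e a a' h h' :
  a <= a' -> h <= h' -> code w eps2 s e a h -> code w eps2 s e a' h'.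
Proof.
move=> aa' hh' [T [c [cT cP]]]; exists T, c; split.
  by apply: le_trans cT _; rewrite ler_expR.
move=> x /cP[k hk]; exists k; apply: le_trans hk _; by rewrite lerD2l.
Qed.

Lemma sum_geometric (q : R) J : 0 <= q -> \sum_(j < J) q ^+ j * (1 - q) <= 1.
Proof.
move=> q0; have -> : \sum_(j < J) q ^+ j * (1 - q) = 1 - q ^+ J.
  elim: J => [|J IH]; first by rewrite big_ord0 expr0 subrr.
  by rewrite big_ord_recr/= IH exprS; ring.
by rewrite gerBl exprn_ge0.
Qed.

(** The weights q ^ j * (1 - q) will be the relative lengths of the blocks, and j + 1 the cost per
    coordinate in units of - b * ln q. *)
Lemma sum_geometric_linear (q : R) J : 0 <= q -> q < 1 ->
  \sum_(j < J) q ^+ j * (1 - q) * j.+1%:R <= (1 - q)^-1.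
Proof.
move=> q0 q1; have q10 : 0 < 1 - q by rewrite subr_gt0.
rewrite -[leRHS]mul1r ler_pdivlMr//.
have -> : (\sum_(j < J) q ^+ j * (1 - q) * j.+1%:R) * (1 - q) =
    1 - q ^+ J * (J%:R * (1 - q) + 1).
  elim: J => [|J IH]; first by rewrite big_ord0 expr0; ring.
  by rewrite big_ord_recr/= mulrDl IH exprS -!natr1; ring.
by rewrite gerBl mulr_ge0 ?exprn_ge0// addr_ge0// mulr_ge0// ltW.
Qed.

End Codes.

(** * Covers of the ellipsoid *)

Section EllipsoidCover.
Context {R : realType}.
Local Notation Rm := (measurableTypeR R).

Lemma nneseries_le_partial (u : nat -> R) (M : R) : (forall k, 0 <= u k) ->
  (\sum_(0 <= k <oo) (u k)%:E <= M%:E)%E <-> forall n, \sum_(i < n) u i <= M.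
Proof.
move=> u0; split => [h n|h].
  rewrite -lee_fin -(big_mkord xpredT) -sumEFin; apply: le_trans h.
  by apply: nneseries_lim_ge => k _ _; rewrite lee_fin.
apply: lime_le.
  by apply: is_cvg_nneseries => k _ _; rewrite lee_fin.
by apply: nearW => n; rewrite sumEFin lee_fin big_mkord.
Qed.

Lemma sum_support_le (u : nat -> R) d n : (forall i, 0 <= u i) ->
  (forall i, (d <= i)%N -> u i = 0) -> \sum_(i < n) u i <= \sum_(i < d) u i.
Proof.
move=> u0 ud; rewrite -!(big_mkord xpredT u); have [nd|dn] := leqP n d.
  by rewrite (big_cat_nat (leq0n n) nd)/= lerDl sumr_ge0.
rewrite (big_cat_nat (leq0n d) (ltnW dn))/= [X in _ + X](_ : _ = 0) ?addr0//.
by rewrite big_nat big1// => i /andP[/ud].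
Qed.

Lemma norm2E (x : nat -> R) :
  norm2 x = ((\sum_(0 <= k <oo) (x k ^+ 2)%:E) `^ 2^-1)%E.
Proof.
rewrite /norm2 Lnorm_counting//; congr (_ `^ _)%E.
apply: eq_eseriesr => k _; rewrite /=; congr EFin.
by rewrite powR_mulrn// real_normK ?num_real.
Qed.

Lemma norm2_le (x : nat -> R) (e : R) : 0 <= e ->
  (norm2 x <= e%:E)%E <-> forall n, \sum_(i < n) x i ^+ 2 <= e ^+ 2.
Proof.
move=> e0; rewrite -(nneseries_le_partial _ (fun k => sqr_ge0 (x k))) norm2E.
have : (0 <= \sum_(0 <= k <oo) (x k ^+ 2)%:E)%E.
  by apply: nneseries_ge0 => k _ _; rewrite lee_fin sqr_ge0.
case: (X in (0 <= X)%E -> _) => [s| |]//=.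
  rewrite !lee_fin => s0; rewrite powR12_sqrt//.
  have sq0 := sqrtr_ge0 s; split => h.
    by rewrite -(sqr_sqrtr s0); apply: lerXn2r; rewrite ?nnegrE.
  by rewrite -(ger0_norm e0) -sqrtr_sqr ler_wsqrtr.
by rewrite /= ifF ?invr_eq0 ?pnatr_eq0// !leye_eq.
Qed.

Lemma norm2_lty (x : nat -> R) (e : R) : 0 <= e ->
  (forall n, \sum_(i < n) x i ^+ 2 <= e ^+ 2) -> ell2 x.
Proof.
by move=> e0 /(norm2_le x e0) h; rewrite /ell2/=; apply: le_lt_trans h _; rewrite ltry.
Qed.

(** One finite cover makes the minimum exist, so [xget] does not return its default 0. *)
Lemma covering_number_spec (eps : R) A n : has_cover eps A n ->
  has_cover eps A (covering_number eps A) /\ (covering_number eps A <= n)%N.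
Proof.
move=> hn; have ex : exists m, `[< has_cover eps A m >] by exists n; apply/asboolP.
have [m /asboolP hm mmin] := ex_minnP ex.
have : [set n | has_cover eps A n /\ forall m, has_cover eps A m -> (n <= m)%N]
    (covering_number eps A).
  apply: xgetPex; exists m; split => // m' hm'.
  by apply: mmin; exact/asboolP.
by case=> h1 h2; split => //; exact: h2.
Qed.

Lemma volume_le_cover m (I : eqType) (L : seq I) (B : I -> set (m.-tuple Rm))
    (A : set (m.-tuple Rm)) :
  measurable A -> (forall c, measurable (B c)) ->
  (forall t, A t -> exists2 c, c \in L & B c t) ->
  (volume m A <= \sum_(c <- L) volume m (B c))%E.
Proof.
elim: L A => [|c L IH] A mA mB AB.
  rewrite big_nil (_ : A = set0) ?measure0//.
  by apply/seteqP; split => // t /AB[].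
rewrite big_cons; apply: (@le_trans _ _ (volume m (B c) + volume m (A `\` B c))%E).
  apply: le_trans (measureU2 (volume m) (mB c) (measurableD mA (mB c))).
  apply: (le_measure (volume m)); rewrite ?inE//.
    by apply: measurableU => //; exact: measurableD.
  by move=> t At; have [Bt|nBt] := pselect (B c t); [left|right].
apply: leeD => //; apply: IH => //; first exact: measurableD.
move=> t [/AB[c']]; rewrite inE => /orP[/eqP ->//|c'L Bt _]; by exists c'.
Qed.

Variables (mu : nat -> R).
Hypotheses (mu_gt0 : forall n : nat, (1 <= n)%N -> 0 < mu n)
  (mu_noninc : forall m n : nat, (1 <= m)%N -> (m <= n)%N -> mu n <= mu m).
Local Notation w := (fun i : nat => mu i.+1 ^- 2).

Lemma ellipsoid_partial x : ellipsoid2 mu x -> forall n, \sum_(i < n) w i * x i ^+ 2 <= 1.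
Proof.
move=> [_ /(nneseries_le_partial 1 (fun k => sqr_ge0 `|x k / mu k.+1|)) h] n.
apply: le_trans (h n); apply: ler_sum => i _.
by rewrite real_normK ?num_real// exprMn exprVn mulrC.
Qed.

(** The coordinates from [d] on are replaced by 0. Their squares are at most mu d ^ 2 <= eps2 times
    their energy, so the tail obeys the same proportional budget as the code, and the energies add
    up to at most 1. *)
Lemma cover_of_code (eps2 eps a h : R) d : 0 < eps -> (1 <= d)%N -> mu d ^+ 2 <= eps2 ->
  eps2 + a <= eps ^+ 2 -> code w eps2 0 d a h ->
  exists n, has_cover eps (ellipsoid2 mu) n /\ n%:R <= expR h.
Proof.
move=> eps0 d1 mueps epsa [T [c [cT cP]]].
(* Coding the zero sequence provides an element of [T], the default value for [nth]. *)
have [|k0 _] := cP (fun=> 0).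
  by rewrite big1 => [|i _]; rewrite ?expr0n ?mulr0.
pose c' (j i : nat) : R := if (i < d)%N then c (nth k0 (enum T) j) i else 0.
pose C : set (nat -> R) := c' @` `I_#|T|.
have finC : finite_set C by apply: finite_image; exact: finite_II.
(* Code words may coincide, so [n] is only bounded by the size of [T]. *)
have /finite_setP[n Cn] := finC.
exists n; split; last first.
  apply: le_trans cT; rewrite ler_nat -card_le_II.
  have := card_image_le c' `I_#|T|; apply: card_le_trans.
  by move: Cn; rewrite card_eq_le => /andP[].
exists C; split => //.
  move=> _ [j _ <-]; pose S := \sum_(i < d) c' j i ^+ 2.
  have S0 : 0 <= S by apply: sumr_ge0 => i _; exact: sqr_ge0.
  apply: (@norm2_lty _ (Num.sqrt S)); first exact: sqrtr_ge0.
  move=> n'; rewrite sqr_sqrtr//; apply: (@sum_support_le (fun i => c' j i ^+ 2)) => [i|i di]; first exact: sqr_ge0.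
  by rewrite /c' ltnNge di expr0n.
move=> x /ellipsoid_partial xE.
have [|k hk] := cP x; first by rewrite big_mkord.
exists (c' (index k (enum T))).
  by exists (index k (enum T)) => //=; rewrite cardE index_mem mem_enum.
have c'E i : c' (index k (enum T)) i = if (i < d)%N then c k i else 0.
  by rewrite /c' nth_index// mem_enum.
apply/norm2_le; first exact: ltW.
move=> n'; set e := maxn n' d.
have de : (d <= e)%N by exact: leq_maxr.
apply: le_trans epsa.
apply: (@le_trans _ _ (\sum_(0 <= i < e) (x i - c' (index k (enum T)) i) ^+ 2)).
  rewrite -(big_mkord xpredT (fun i => (x \- c' (index k (enum T))) i ^+ 2)).
  rewrite [leRHS](big_cat_nat (leq0n n') (leq_maxl _ _))/= lerDl.
  by apply: sumr_ge0 => i _; exact: sqr_ge0.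
have eps20 : 0 <= eps2 by apply: le_trans mueps; exact: sqr_ge0.
have := xE e; rewrite -(big_mkord xpredT (fun i => w i * x i ^+ 2)).
rewrite (big_cat_nat (leq0n d) de)/= => /(ler_wpM2l eps20).
rewrite mulr1 mulrDr => he.
rewrite (big_cat_nat (leq0n d) de)/=.
have -> : \sum_(0 <= i < d) (x i - c' (index k (enum T)) i) ^+ 2 =
    \sum_(0 <= i < d) (x i - c k i) ^+ 2.
  by apply: eq_big_nat => i /andP[_ im]; rewrite c'E im.
have : \sum_(d <= i < e) (x i - c' (index k (enum T)) i) ^+ 2 <=
    eps2 * \sum_(d <= i < e) w i * x i ^+ 2.
  rewrite mulr_sumr; apply: ler_sum_nat => i /andP[di _].
  rewrite c'E ltnNge di/= subr0 mulrA -[leLHS]mul1r ler_wpM2r ?sqr_ge0//.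
  rewrite ler_pdivlMr ?exprn_gt0 ?mu_gt0// mul1r; apply: le_trans mueps.
  apply: lerXn2r; rewrite ?nnegrE ?(ltW (mu_gt0 _))//.
  by apply: mu_noninc => //; exact: leqW.
by move: hk he; lra.
Qed.

(** Extend the points of the section by zero. Truncating the centers does not increase distances, so
    N balls of radius [eps] in R^d cover the section; compare volumes. *)
Lemma cover_lower_bound (eps : R) N d : 0 < eps -> has_cover eps (ellipsoid2 mu) N ->
  \prod_(i < d) (mu i.+1) <= N%:R * eps ^+ d.
Proof.
move=> eps0 [C [CN _ Ccov]].
have finC : finite_set C by apply/finite_setP; exists N.
pose L : seq (nat -> R) := finmap.enum_fset (fset_set C).
have sL : size L = N by exact: card_fset_set.
pose B (c : nat -> R) : set (d.-tuple Rm) := ellipsoid_set (fun=> 1) c eps.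
pose E : set (d.-tuple Rm) := ellipsoid_set (fun i => mu i.+1) (fun=> 0) 1.
have mB c : measurable (B c) by exact: measurable_ellipsoid_set.
have mE : measurable E by exact: measurable_ellipsoid_set.
have muS i : 0 < mu i.+1 by exact: mu_gt0.
have EB t : E t -> exists2 c, c \in L & B c t.
  move=> Et; pose x i : R := nth 0 t i.
  have x0 i : (d <= i)%N -> x i = 0 by move=> di; rewrite /x nth_default// size_tuple.
  have xE : ellipsoid2 mu x.
    split.
      pose S := \sum_(i < d) x i ^+ 2.
      have S0 : 0 <= S by apply: sumr_ge0 => i _; exact: sqr_ge0.
      apply: (@norm2_lty _ (Num.sqrt S)); first exact: sqrtr_ge0.
      move=> n; rewrite sqr_sqrtr//; apply: (@sum_support_le (fun i => x i ^+ 2)) => [i|i di].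
        exact: sqr_ge0.
      by rewrite x0// expr0n.
    apply/nneseries_le_partial => [k|n]; first exact: sqr_ge0.
    apply: (@le_trans _ _ (\sum_(i < d) `|x i / mu i.+1| ^+ 2)).
      apply: (@sum_support_le (fun i => `|x i / mu i.+1| ^+ 2)) => [i|i di]; first exact: sqr_ge0.
      by rewrite x0// mul0r normr0 expr0n.
    move: Et; rewrite /E /ellipsoid_set/= expr1n; apply: le_trans.
    apply: ler_sum => i _.
    by rewrite real_normK ?num_real// subr0 (tnth_nth 0).
  have [c Cc hc] := Ccov x xE.
  exists c; first by rewrite in_fset_set// inE.
  move/norm2_le: hc => /(_ (ltW eps0) d) hc.
  rewrite /B /ellipsoid_set/=; apply: le_trans hc; apply: ler_sum => i _.
  by rewrite divr1 (tnth_nth 0).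
have := volume_le_cover mE mB EB.
rewrite /E volume_ellipsoid_set// (eq_bigr (fun=> (eps ^+ d * ball_volume d)%:E)); last first.
  by move=> c _; rewrite volume_ellipsoid_set// big1 ?mulr1.
rewrite sumEFin lee_fin expr1n mul1r big_const_seq count_predT sL iter_addr addr0.
by rewrite -[leRHS]mulr_natl mulrA ler_pM2r// (volume_unit_ball d).2.
Qed.

End EllipsoidCover.

(** * Regular variation *)

Section RegularVariation.
Context {R : realType}.
Variables (b : R) (mu : nat -> R).
Hypotheses (b_gt0 : 0 < b) (mu_gt0 : forall n : nat, (1 <= n)%N -> 0 < mu n)
  (mu_noninc : forall m n : nat, (1 <= m)%N -> (m <= n)%N -> mu n <= mu m)
  (mu_rv : regularly_varying mu (- b)).

Local Notation fl a n := (Num.truncn (a * n%:R : R)).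

Lemma rv_upper (a l : R) : 0 < a -> a `^ (- b) < l ->
  exists N : nat, forall n, (N <= n)%N -> mu (fl a n) <= l * mu n.
Proof.
move=> a0 al; have : \forall n \near \oo, mu (fl a n) / mu n < l.
  by apply: (cvgr_lt _ (mu_rv a0)).
(* The successor excludes the irrelevant value at n = 0. *)
case=> N _ HN; exists N.+1 => n Nn.
have n0 : 0 < mu n by apply: mu_gt0; exact: leq_ltn_trans Nn.
by rewrite -ler_pdivrMr//; apply/ltW/HN; exact: ltnW.
Qed.

Lemma rv_lower (a l : R) : 0 < a -> l < a `^ (- b) ->
  exists N : nat, forall n, (N <= n)%N -> l * mu n <= mu (fl a n).
Proof.
move=> a0 al; have : \forall n \near \oo, l < mu (fl a n) / mu n.
  by apply: (cvgr_gt _ (mu_rv a0)).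
case=> N _ HN; exists N.+1 => n Nn.
have n0 : 0 < mu n by apply: mu_gt0; exact: leq_ltn_trans Nn.
by rewrite -ler_pdivlMr//; apply/ltW/HN; exact: ltnW.
Qed.

Lemma fl_le (a : R) n : 0 <= a -> a <= 1 -> (fl a n <= n)%N.
Proof.
by move=> a0 a1; rewrite -[leqRHS](@natrK R) le_truncn// ler_piMl.
Qed.

Lemma fl_ge (a : R) k : 0 < a -> exists N : nat, forall n, (N <= n)%N -> (k <= fl a n)%N.
Proof.
move=> a0; exists (Num.truncn (k%:R / a)).+1 => n Nn.
rewrite truncn_ge_nat ?mulr_ge0 ?(ltW a0)// [leRHS]mulrC -ler_pdivrMr//.
by apply/ltW/(lt_le_trans (truncnS_gt _)); rewrite ler_nat.
Qed.

Lemma fl_bounds (a : R) n : 0 <= a -> (fl a n)%:R <= a * n%:R < (fl a n)%:R + 1.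
Proof. by move=> a0; rewrite natr1; apply: truncn_itv; rewrite mulr_ge0. Qed.

(** * Growth of the logarithmic volume of the sections *)

Definition logsum d : R := \sum_(i < d) ln (mu i.+1 / mu d).

Lemma ln_mu_ge0 m d : (1 <= m)%N -> (m <= d)%N -> 0 <= ln (mu m / mu d).
Proof.
move=> m1 md; rewrite ln_ge0// ler_pdivlMr ?mul1r ?mu_noninc// mu_gt0//.
exact: leq_trans md.
Qed.

Lemma ln_mu_mul i m d : (1 <= i)%N -> (1 <= m)%N -> (1 <= d)%N ->
  ln (mu i / mu d) = ln (mu i / mu m) + ln (mu m / mu d).
Proof.
move=> i1 m1 d1; have [i0 m0 d0] : [/\ 0 < mu i, 0 < mu m & 0 < mu d] by split; apply: mu_gt0.
rewrite -lnM ?posrE ?divr_gt0//; congr ln; field.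
by rewrite !gt_eqF.
Qed.

(** Passing from the reference [mu d] to [mu m] changes each of the first [m] terms by the same
    constant. This recursion drives both bounds below. *)
Lemma logsum_split m d : (1 <= m)%N -> (m <= d)%N ->
  logsum d = logsum m + m%:R * ln (mu m / mu d) + \sum_(m <= i < d) ln (mu i.+1 / mu d).
Proof.
move=> m1 md; rewrite /logsum -!(big_mkord xpredT (fun i => ln (mu i.+1 / mu _))).
rewrite (big_cat_nat (n := m))//=; congr (_ + _).
rewrite [LHS](eq_bigr (fun i => ln (mu i.+1 / mu m) + ln (mu m / mu d))); last first.
  by move=> i _; apply: ln_mu_mul => //; exact: leq_trans md.
by rewrite big_split/= sumr_const_nat subn0 mulr_natl.
Qed.

Lemma logsum_ge0 d : 0 <= logsum d.
Proof. by apply: sumr_ge0 => i _; exact: ln_mu_ge0. Qed.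

(** Induction from m = floor (q * d) to d: the split contributes at least lam * m, the terms beyond
    [m] are bounded below by 0, and c * d obeys the recursion because c * (1 - q) < lam * q. *)
Lemma logsum_lower (c : R) : 0 <= c -> c < b -> exists C0 : R,
  forall d, (1 <= d)%N -> c * d%:R - C0 <= logsum d.
Proof.
move=> c0 cb.
have cb1 : c / b < 1 by rewrite ltr_pdivrMr// mul1r.
have cb0 : 0 <= c / b by rewrite divr_ge0// ltW.
(* With c < q * b there is room for [lam] between c * (1 - q) / q and b * (1 - q), and the latter is
   at most - b * ln q. *)
have [q [q0 q1 cqb]] : exists q, [/\ 0 < q, q < 1 & c < q * b].
  exists ((c / b + 1) / 2).
  by split; [apply: divr_gt0 => //; apply: ltr_wpDl|rewrite midf_lt|
    rewrite -ltr_pdivrMr// midf_lt].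
have [lam [lam1 lam2]] : exists lam, lam < b * (1 - q) /\ c * (1 - q) < lam * q.
  have cq1 : c * (1 - q) / q < b * (1 - q).
    by rewrite ltr_pdivrMr// mulrAC ltr_pM2r ?subr_gt0// mulrC.
  exists ((c * (1 - q) / q + b * (1 - q)) / 2).
  by split; [rewrite midf_lt|rewrite -ltr_pdivrMr// midf_lt].
have lam0 : 0 < lam.
  rewrite -(@ltr_pM2r _ q)// mul0r; apply: le_lt_trans lam2.
  by rewrite mulr_ge0// subr_ge0 ltW.
have [|N HN] := @rv_lower q (expR lam) q0.
  rewrite /powR gt_eqF// ltr_expR; apply: (lt_le_trans lam1).
  rewrite mulNr -mulrN ler_pM2l//; have := @le_ln1Dx R (q - 1).
  by rewrite addrCA subrr addr0 => /(_ _); lra.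
have [N1 HN1] := fl_ge 1 q0.
(* From [D] on, the loss c + lam due to the integer part in [m] is absorbed by the gain ((c + lam) *
   q - c) * d; below [D] the claimed bound is not positive. *)
pose D := maxn (maxn N N1) (Num.truncn ((c + lam) / ((c + lam) * q - c))).+1.
have cl : 0 < (c + lam) * q - c by lra.
exists (c * D%:R) => d; elim/ltn_ind: d => d IH d1.
have [dD|Dd] := ltnP d D.
  apply: le_trans (logsum_ge0 d); rewrite subr_le0 ler_wpM2l// ler_nat; exact: ltnW.
move: (Dd); rewrite !geq_max -andbA => /and3P[dN dN1 dT].
pose m := fl q d.
have m1 : (1 <= m)%N by exact: HN1.
have /andP[mq1 mq2] := fl_bounds d (ltW q0).
have md : (m < d)%N.
  rewrite -(ltr_nat R); apply: le_lt_trans mq1 _; by rewrite gtr_pMl// ltr0n.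
have mul : lam <= ln (mu m / mu d).
  rewrite -[leLHS]expRK ler_ln ?posrE ?expR_gt0 ?divr_gt0 ?mu_gt0//.
  by rewrite ler_pdivlMr ?mu_gt0// HN.
rewrite (logsum_split m1 (ltnW md)).
have t0 : 0 <= \sum_(m <= i < d) ln (mu i.+1 / mu d).
  by rewrite big_nat; apply: sumr_ge0 => i /andP[_ ?]; exact: ln_mu_ge0.
have := IH _ md m1.
have : m%:R * lam <= m%:R * ln (mu m / mu d) by rewrite ler_wpM2l.
have : (c + lam) * (q * d%:R - 1) <= (c + lam) * m%:R.
  by rewrite ler_pM2l ?ltr_wpDl//; rewrite -/m in mq2; lra.
have : c + lam <= ((c + lam) * q - c) * d%:R.
  rewrite mulrC -ler_pdivrMr//; apply/ltW/(lt_le_trans (truncnS_gt _)).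
  by rewrite ler_nat.
lra.
Qed.

(** The same recursion with m = floor (d / 2): every new contribution is at most [lam] per
    coordinate, and C * m + lam * d <= C * d once C >= 2 * lam. *)
Lemma logsum_upper : exists2 C : R, 0 <= C & forall d, (1 <= d)%N -> logsum d <= C * d%:R.
Proof.
have h0 : 0 < 2^-1 :> R by rewrite invr_gt0.
pose lam := ln ((2^-1 : R) `^ (- b) + 1).
have l0 : 0 < (2^-1 : R) `^ (- b) + 1 by rewrite ltr_wpDl// powR_ge0.
have [|N HN] := @rv_upper 2^-1 (expR lam) h0.
  by rewrite /lam lnK ?posrE// ltrDl.
have [N1 HN1] := fl_ge 1 h0.
have lam0 : 0 <= lam by rewrite ln_ge0// lerDr powR_ge0.
pose D := maxn (maxn N N1) 1.
have D1 : (1 <= D)%N by rewrite leq_maxr.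
have lD := ln_mu_ge0 (leqnn 1) D1.
(* The second term settles d < D, where it bounds each summand. *)
exists (2 * lam + ln (mu 1%N / mu D)); first by rewrite addr_ge0// mulr_ge0.
set C := _ + _; have C0 : 0 <= C by rewrite addr_ge0// mulr_ge0.
elim/ltn_ind => d IH d1.
have [dD|Dd] := ltnP d D.
  apply: (@le_trans _ _ (\sum_(i < d) C)); last by rewrite sumr_const card_ord mulr_natr.
  apply: ler_sum => i _; apply: (@le_trans _ _ (ln (mu 1%N / mu D))); last by rewrite lerDr mulr_ge0.
  rewrite ler_ln ?posrE ?divr_gt0 ?mu_gt0//.
  apply: ler_pM; [exact/ltW/mu_gt0| | exact: mu_noninc|].
    by rewrite invr_ge0 ltW// mu_gt0.
  by rewrite lef_pV2 ?posrE ?mu_gt0// mu_noninc// ltnW.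
move: (Dd); rewrite !geq_max -andbA => /and3P[dN dN1 _].
pose m := fl 2^-1 d.
have m1 : (1 <= m)%N by exact: HN1.
have /andP[mq1 mq2] := fl_bounds d (ltW h0).
have md : (m < d)%N.
  rewrite -(ltr_nat R); apply: le_lt_trans mq1 _; rewrite gtr_pMl ?ltr0n//; first lra.
have mul : ln (mu m / mu d) <= lam.
  rewrite -[leRHS]expRK ler_ln ?posrE ?expR_gt0 ?divr_gt0 ?mu_gt0//.
  by rewrite ler_pdivrMr ?mu_gt0// HN.
rewrite (logsum_split m1 (ltnW md)).
have t0 : \sum_(m <= i < d) ln (mu i.+1 / mu d) <= (d%:R - m%:R) * lam.
  apply: (@le_trans _ _ (\sum_(m <= i < d) lam)); last first.
    by rewrite sumr_const_nat mulrC -natrB ?mulr_natr// ltnW.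
  apply: ler_sum_nat => i /andP[mi id]; apply: le_trans mul.
  by rewrite ler_ln ?posrE ?divr_gt0 ?mu_gt0// ler_pM2r ?invr_gt0 ?mu_gt0// mu_noninc// ltnW.
have := IH _ md m1.
have : m%:R * ln (mu m / mu d) <= m%:R * lam by rewrite ler_wpM2l.
have : C * m%:R <= C * (2^-1 * d%:R) by rewrite ler_wpM2l.
have : 2 * lam * d%:R <= C * d%:R by rewrite ler_wpM2r// /C lerDl.
lra.
Qed.

(** Doubling the index multiplies [mu] by at most some q < 1, chosen halfway between 2 ^ (- b) and
    1. *)
Lemma mu_cvg0 (e : R) : 0 < e -> exists2 n, (1 <= n)%N & mu n <= e.
Proof.
move=> e0; have h0 : 0 < 2 :> R by [].
pose q := ((2 : R) `^ (- b) + 1) / 2.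
have p1 : (2 : R) `^ (- b) < 1.
  by rewrite /powR pnatr_eq0/= -[ltRHS]expR0 ltr_expR mulNr oppr_lt0 mulr_gt0// ln_gt0// ltr1n.
have p0 := powR_ge0 (2 : R) (- b).
have q0 : 0 < q by rewrite /q; lra.
have q1 : q < 1 by rewrite /q; lra.
have [|N HN] := @rv_upper 2 q h0; first by rewrite /q; lra.
pose M := N.+1.
have M0 : 0 < mu M by exact: mu_gt0.
have iter k : mu (2 ^ k * M) <= q ^+ k * mu M.
  elim: k => [|k IH]; first by rewrite expn0 mul1n mul1r.
  have := HN (2 ^ k * M)%N; rewrite -natrM natrK mulnA -expnS exprS -mulrA => h.
  apply: le_trans (h _) _; last by rewrite ler_pM2l.
  by rewrite /M (leq_trans (leqnSn N))// leq_pmull// expn_gt0.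
have [|k0 Hk] := @linear_le_geometric R q^-1 (mu M / e); first by rewrite invf_gt1.
pose k := maxn k0 1; exists (2 ^ k * M)%N; first by rewrite muln_gt0 expn_gt0.
apply: le_trans (iter k) _; have := Hk k (leq_maxl _ _).
rewrite exprVn [X in X + 1]mulrC => hk.
rewrite -ler_pdivlMl ?exprn_gt0// -ler_pdivrMr//.
apply: le_trans hk; apply: le_trans (_ : k%:R * (mu M / e) <= _); last by rewrite lerDl.
by rewrite ler_peMl ?divr_ge0 ?(ltW e0) ?(ltW M0)// ler1n leq_maxr.
Qed.

(** * Codes for the first d coordinates of the ellipsoid *)

Local Notation w := (fun i : nat => mu i.+1 ^- 2).

(** The blocks run from about q ^ (j + 1) * d to q ^ j * d. There [mu] is at most about q ^ (- b *
    (j + 1)) * mu d, so relative radius q ^ (b * (j + 1)) suffices; [kap] absorbs the error in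
    regular variation, and [B] the rounding of lengths and the terms ln (K + 1). *)
Lemma code_blocks (q kap eta : R) (K J : nat) : 0 < q -> q < 1 -> 1 < kap -> 0 < eta ->
  (0 < K)%N -> exists D B, forall d, (D <= d)%N ->
  code w (kap * mu d ^+ 2) (fl (q ^+ J) d) d (J%:R * (kap * mu d ^+ 2 / K%:R))
    (B + d%:R * \sum_(j < J) q ^+ j * (1 - q) * (eta + b * j.+1%:R * - ln q)).
Proof.
move=> q0 q1 k1 eta0 K0; elim: J => [|J [D [B IH]]].
  exists 0%N, 0 => d _; rewrite expr0 mul1r natrK big_ord0 mul0r mulr0 addr0.
  exact: code_empty.
have lq : 0 < - ln q by rewrite oppr_gt0 ln_lt0// q0.
pose g := eta + b * J.+1%:R * - ln q.
have g0 : 0 < g by rewrite addr_gt0// !mulr_gt0.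
have qn0 n : 0 < q ^+ n by rewrite exprn_gt0.
pose rho := (q ^+ J.+1) `^ b.
have rho0 : 0 < rho by rewrite powR_gt0.
have lrho : ln rho = b * J.+1%:R * ln q by rewrite ln_powR lnXn// -mulrA mulr_natl.
have rho1 : rho < 1.
  by rewrite -(ltr_ln rho0 ltr01) ln1 lrho -oppr_gt0 -mulrN !mulr_gt0.
have [m0 Hm0] := code_block rho0 rho1 eta0 K0.
have [|N1 HN1] := @rv_upper (q ^+ J.+1) (Num.sqrt kap / rho) (qn0 _).
  by rewrite powRN ltr_pdivlMr// mulVf ?gt_eqF// -[ltLHS]sqrtr1 ltr_sqrt// (lt_trans _ k1).
have [N2 HN2] := fl_ge 1 (qn0 J.+1).
have qJ0 : 0 < q ^+ J * (1 - q) by rewrite mulr_gt0 ?subr_gt0.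
have [N3 HN3] := fl_ge m0.+1 qJ0.
exists (maxn (maxn D N1) (maxn (maxn N2 N3) 1)), (B + ln K.+1%:R + g) => d.
rewrite !geq_max => /andP[/andP[dD d1] /andP[/andP[d2 d3] dd]].
set s := fl (q ^+ J.+1) d; set e := fl (q ^+ J) d.
have /andP[s1 s2] : s%:R <= q ^+ J.+1 * d%:R < s%:R + 1 by apply: fl_bounds; exact: ltW.
have /andP[e1 e2] : e%:R <= q ^+ J * d%:R < e%:R + 1 by apply: fl_bounds; exact: ltW.
have s_ge1 : (1 <= s)%N by exact: HN2.
have se : (s + m0 <= e)%N.
  have := HN3 _ d3; rewrite truncn_ge_nat ?(mulr_ge0 (ltW qJ0))// => h3.
  rewrite -ltnS -(ltr_nat R) -natr1 natrD; apply: le_lt_trans e2.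
  by move: s1 h3; rewrite exprS -natr1; lra.
have ed : (e <= d)%N by apply: fl_le; rewrite ?exprn_ile1// ltW.
have mus : 0 < mu s by exact: mu_gt0.
have mud : 0 < mu d by exact: mu_gt0.
have cb := IH d dD.
have ca : code w (kap * mu d ^+ 2) s e (kap * mu d ^+ 2 / K%:R)
    (ln K.+1%:R + (e - s)%N%:R * (eta - ln rho)).
  apply: (Hm0 _ _ (mu s)) => //.
  - move=> i si ie; rewrite lef_pV2 ?posrE ?exprn_gt0 ?mu_gt0//.
    apply: lerXn2r; rewrite ?nnegrE ?(ltW mus) ?(ltW (mu_gt0 _))//.
    by apply: mu_noninc => //; exact: leqW.
  - have := HN1 d d1; rewrite -/s mulrAC ler_pdivlMr// => h1.
    have k0 : 0 <= kap by rewrite (le_trans _ (ltW k1)).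
    rewrite -exprMn -(sqr_sqrtr k0) -exprMn.
    apply: lerXn2r => //; rewrite nnegrE mulr_ge0 ?sqrtr_ge0 ?(ltW mus) ?(ltW rho0) ?(ltW mud)//.
have := code_concat _ (leq_trans (leq_addr m0 s) se) ed ca cb.
move=> /(_ (fun i => _)) H.
apply: code_weaken (H _) => [||i]; last by rewrite invr_ge0 exprn_ge0// ltW// mu_gt0.
  by rewrite -natr1 mulrDl mul1r addrC.
rewrite big_ord_recr/= -/g lrho -[eta - _]/(eta + - _) -mulrN -/g.
have : (e - s)%N%:R <= q ^+ J * (1 - q) * d%:R + 1.
  rewrite natrB ?(leq_trans (leq_addr m0 s) se)//.
  by move: s2 e1; rewrite exprS; lra.
move=> /(ler_wpM2r (ltW g0)).
by rewrite mulrDr; lra.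
Qed.

(** A net for the first q ^ J * d coordinates is joined to the [J] blocks. The excess eta * d has
    four equal shares: the head, the loss of [ball_cover], the discretization by [q], and the
    constant [B]. The slack is halved between the head and the rounding of energies. *)
Lemma upper_code (kap eta : R) : 1 < kap -> kap <= 2 -> 0 < eta ->
  exists D, forall d, (D <= d)%N -> (1 <= d)%N /\
  code w (kap * mu d ^+ 2) 0 d ((kap ^+ 2 - kap) * mu d ^+ 2) ((b + eta) * d%:R).
Proof.
move=> k1 k2 eta0.
have k0 : 0 < kap by apply: lt_trans k1.
pose eta4 := eta / 4; have eta40 : 0 < eta4 by rewrite divr_gt0.
(* The blocks cost at most b * L / (1 - q) per coordinate, with L = - ln q; this is at most b /
   q. *)
have [q [q0 q1 qb]] : exists q, [/\ 0 < q, q < 1 & b / q = b + eta4].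
  exists (b / (b + eta4)); split; first by rewrite divr_gt0// addr_gt0.
    by rewrite ltr_pdivrMr ?addr_gt0// mul1r ltrDl.
  by field; rewrite !gt_eqF// addr_gt0.
pose L := - ln q.
have L0 : 0 < L by rewrite oppr_gt0 ln_lt0// q0.
have Lq : L / (1 - q) <= q^-1.
  rewrite ler_pdivrMr ?subr_gt0// /L -lnV ?posrE// mulrBr mulr1 mulVf ?gt_eqF//.
  have := @le_ln1Dx R (q^-1 - 1); rewrite addrCA subrr addr0; apply.
  by rewrite ltrBrDr addNr invr_gt0.
have [C C0 HC] := logsum_upper.
(* The radius of the head net in units of [mu d]; its square is half of the slack. *)
pose th := Num.sqrt (kap * (kap - 1) / 2).
have th20 : 0 < kap * (kap - 1) / 2 by rewrite divr_gt0// mulr_gt0// subr_gt0.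
have th0 : 0 < th by rewrite sqrtr_gt0.
have thE : th ^+ 2 = kap * (kap - 1) / 2 by rewrite sqr_sqrtr// ltW.
have th1 : th <= 2.
  rewrite -(@ler_pXn2r _ 2)// ?nnegrE ?(ltW th0)// thE; nra.
(* A factor 4 / th comes from the net; the remaining 2 from the crude bound mu m / mu d <= 2 * q ^
   (- J * b), which is enough for the short head. *)
pose C' := C + ln (8 / th).
have C'0 : 0 <= C'.
  by rewrite addr_ge0// ln_ge0// ler_pdivlMr// mul1r; lra.
have [|J0 HJ0] := @linear_le_geometric R q^-1 ((C' + b * L) / eta4).
  by rewrite invf_gt1.
pose J := maxn J0 1.
have qJ0 : 0 < q ^+ J by rewrite exprn_gt0.
have HJ : q ^+ J * (C' + b * (J%:R * L)) <= eta4.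
  have := HJ0 J (leq_maxl _ _).
  have J1 : 1 <= J%:R :> R by rewrite ler1n leq_maxr.
  rewrite exprVn => hJ.
  rewrite -ler_pdivlMl// -ler_pdivrMr//.
  apply: le_trans hJ; apply: (@le_trans _ _ ((C' + b * L) / eta4 * J%:R)); last by rewrite lerDl.
  rewrite mulrAC ler_pM2r ?invr_gt0// mulrDl lerD ?ler_peMr//.
  by rewrite [J%:R * L]mulrC mulrA.
pose K := (Num.truncn (2 * J%:R / (kap - 1))).+1.
have HK : J%:R * (kap / K%:R) <= kap * (kap - 1) / 2.
  have hK : 2 * J%:R / (kap - 1) < K%:R by exact: truncnS_gt.
  move: hK; rewrite ltr_pdivrMr ?subr_gt0// => hK.
  rewrite mulrA ler_pdivrMr ?ltr0n//.
  rewrite [leRHS](_ : _ = kap * ((kap - 1) * K%:R / 2)); last by ring.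
  by rewrite mulrC ler_pM2l// ler_pdivlMr//; lra.
have [D1 [B HB]] := @code_blocks q kap eta4 K J q0 q1 k1 eta40 isT.
have [|N1 HN1] := @rv_upper (q ^+ J) (2 * (q ^+ J) `^ (- b)) qJ0.
  by rewrite ltr_pMl ?powR_gt0// ltr1n.
have [N2 HN2] := fl_ge 1 qJ0.
exists (maxn (maxn D1 N1) (maxn (maxn N2 1) (Num.truncn (B / eta4)).+1)) => d.
rewrite !geq_max => /andP[/andP[dD dN1] /andP[/andP[dN2 d1] dB]].
split => //.
have mud : 0 < mu d by exact: mu_gt0.
set m := fl (q ^+ J) d.
have /andP[m1 m2] : m%:R <= q ^+ J * d%:R < m%:R + 1 by apply: fl_bounds; exact: ltW.
have m_ge1 : (1 <= m)%N by exact: HN2.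
have md : (m <= d)%N by apply: fl_le; rewrite ?exprn_ile1// ltW.
have mum : 0 < mu m by exact: mu_gt0.
have cb := HB d dD; rewrite -/m in cb.
have r0 : 0 < th * mu d by rewrite mulr_gt0.
have ch : code w (kap * mu d ^+ 2) 0 m ((th * mu d) ^+ 2)
    (m%:R * (C' + b * (J%:R * L))).
  apply: code_head => //.
  - by move=> i; exact: mu_gt0.
  - move=> i; apply: ler_pM => //; [exact: ltW|exact: ltW|].
    by apply: mu_noninc => //; rewrite (leq_trans (ltn_ord i)).
  - by rewrite mulr_ge0 ?exprn_ge0 ?ltW.
  have muf i : 0 < 4 * mu i.+1 / (th * mu d) by rewrite divr_gt0// mulr_gt0// mu_gt0.
  have -> : \prod_(i < m) (4 * mu i.+1 / (th * mu d)) =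
      expR (\sum_(i < m) ln (4 * mu i.+1 / (th * mu d))).
    by rewrite expR_sum; apply: eq_bigr => i _; rewrite lnK ?posrE.
  rewrite ler_expR.
  have lnmu : ln (mu m / mu d) <= ln 2 + b * (J%:R * L).
    rewrite (_ : b * _ = ln ((q ^+ J) `^ (- b))).
      rewrite -lnM ?posrE ?powR_gt0// ler_ln ?posrE ?divr_gt0 ?mulr_gt0 ?powR_gt0//.
      by rewrite ler_pdivrMr// HN1.
    by rewrite ln_powR lnXn// /L mulrN mulr_natl mulNr mulrN.
  apply: (@le_trans _ _ (\sum_(i < m) (ln (mu i.+1 / mu m) + (ln (4 / th) + ln (mu m / mu d))))).
    apply: ler_sum => i _; have mui : 0 < mu i.+1 by exact: mu_gt0.
    rewrite -lnM ?posrE ?divr_gt0// -lnM ?posrE ?mulr_gt0 ?divr_gt0 ?invr_gt0//.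
    rewrite le_eqVlt; apply/orP; left; apply/eqP; congr ln; field.
    by rewrite !gt_eqF.
  rewrite big_split/= sumr_const card_ord -[X in _ + X <= _]mulr_natl.
  have := HC m m_ge1; rewrite /logsum => hC.
  have -> : C' = C + (ln (4 / th) + ln 2).
    by rewrite /C' -lnM ?posrE ?divr_gt0//; congr (_ + ln _); field; rewrite gt_eqF.
  have : m%:R * ln (mu m / mu d) <= m%:R * (ln 2 + b * (J%:R * L)) by rewrite ler_wpM2l.
  by move: hC; rewrite !mulrDr; lra.
have wge0 i : 0 <= w i by rewrite invr_ge0 exprn_ge0// ltW// mu_gt0.
apply: code_weaken (code_concat wge0 (leq0n m) md ch cb).
  rewrite exprMn thE [leLHS](_ : _ = (kap * (kap - 1) / 2 + J%:R * (kap / K%:R)) * mu d ^+ 2); last by ring.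
  by rewrite ler_pM2r ?exprn_gt0//; rewrite expr2; lra.
have d0 : 0 <= d%:R :> R by [].
have hB : B <= eta4 * d%:R.
  rewrite mulrC -ler_pdivrMr//; apply/ltW/(lt_le_trans (truncnS_gt _)).
  by rewrite ler_nat.
have h1 : m%:R * (C' + b * (J%:R * L)) <= eta4 * d%:R.
  apply: (@le_trans _ _ (q ^+ J * d%:R * (C' + b * (J%:R * L)))).
    by rewrite ler_wpM2r// addr_ge0// !mulr_ge0// ltW.
  by rewrite mulrAC ler_wpM2r.
have h2 : \sum_(j < J) q ^+ j * (1 - q) * (eta4 + b * j.+1%:R * - ln q) <= eta4 + (b + eta4).
  under eq_bigr do rewrite mulrDr.
  rewrite big_split/= -mulr_suml; apply: lerD.
    by rewrite ler_piMl ?(ltW eta40)// sum_geometric// ltW.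
  rewrite (eq_bigr (fun j : 'I_J => (q ^+ j * (1 - q) * j.+1%:R) * (b * L))); last first.
    by move=> j _; rewrite /L; ring.
  rewrite -mulr_suml -qb.
  apply: (@le_trans _ _ ((1 - q)^-1 * (b * L))).
    by rewrite ler_wpM2r ?(mulr_ge0 (ltW b_gt0) (ltW L0))// sum_geometric_linear// ltW.
  by rewrite mulrCA ler_pM2l// mulrC.
have := ler_wpM2l d0 h2.
rewrite (_ : eta = 4 * eta4); last by rewrite /eta4; field.
move: h1 hB; lra.
Qed.

(** * Entropy bounds and the limit *)

Local Notation H eps := (metric_entropy eps (ellipsoid2 mu)).

(** The code at [d] has error kap * mu d, slightly too large. Coding d' = floor ((1 + z) * d)
    coordinates instead brings kap * mu d' below mu d.+1, at the cost of a factor 1 + z in the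
    exponent. *)
Lemma exists_cover (eta : R) : 0 < eta -> exists D, forall d, (D <= d)%N ->
  forall eps, mu d.+1 <= eps ->
  exists n, has_cover eps (ellipsoid2 mu) n /\ n%:R <= expR ((b + eta) * d%:R).
Proof.
move=> eta0.
have [z [z0 z1 zb]] : exists z, [/\ 0 < z, z <= 1 & (b + z) * (1 + z) <= b + eta].
  exists (eta / (b + 2 + eta)).
  have den : 0 < b + 2 + eta by rewrite !addr_gt0.
  have z0 : 0 < eta / (b + 2 + eta) by rewrite divr_gt0.
  have z1 : eta / (b + 2 + eta) <= 1 by rewrite ler_pdivrMr// mul1r lerDr addr_ge0// ltW.
  have z2 : eta / (b + 2 + eta) * (b + 2) <= eta.
    by rewrite mulrAC ler_pdivrMr// ler_pM2l// lerDl ltW.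
  by split => //; move: (eta / _) z0 z1 z2 => z z0 z1 z2; nra.
have z2 : 0 < 1 + z / 2 by rewrite addr_gt0// divr_gt0.
(* Half of [z] is kept back for the passage from d + 1 to d: (1 + z / 2) * (d + 1) <= (1 + z) * d
   for large d. *)
pose P := (1 + z / 2) `^ b.
have P1 : 1 < P.
  rewrite /P /powR gt_eqF// -[ltLHS]expR0 ltr_expR mulr_gt0// ln_gt0//.
  by rewrite ltrDl divr_gt0.
have [kap [k1 k2 kP]] : exists kap, [/\ 1 < kap, kap <= 2 & kap < P].
  exists (Num.min ((1 + P) / 2) 2); split.
  - by rewrite lt_min midf_lt//= ltr1n.
  - by rewrite ge_min lexx orbT.
  - by rewrite gt_min midf_lt.
have k0 : 0 < kap by apply: lt_trans k1.
have [D0 HD0] := upper_code k1 k2 z0.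
have [|N1 HN1] := @rv_upper (1 + z / 2) kap^-1 z2.
  by rewrite powRN ltf_pV2 ?posrE// powR_gt0.
have oz0 : 0 < 1 + z by rewrite addr_gt0.
have [N2 HN2] := fl_ge D0 oz0.
have [N3 HN3] := fl_ge 1 z2.
exists (maxn (maxn N1 N2) (maxn N3 (Num.truncn ((1 + z / 2) / (z / 2))).+1)) => d.
rewrite !geq_max => /andP[/andP[d1 d2] /andP[d3 d4]] eps heps.
set d' := fl (1 + z) d.
have [d'1 cd'] := HD0 d' (HN2 _ d2).
have mud' : 0 < mu d' by exact: mu_gt0.
have muS : 0 < mu d.+1 by exact: mu_gt0.
have eps0 : 0 < eps by exact: lt_le_trans heps.
have kmu : kap * mu d' <= eps.
  apply: le_trans heps; rewrite -ler_pdivlMl//.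
  apply: le_trans (HN1 d.+1 (leqW d1)).
  apply: mu_noninc; first by apply: HN3; exact: leqW.
  apply: le_truncn.
  have : 1 + z / 2 <= d%:R * (z / 2).
    rewrite -ler_pdivrMr ?divr_gt0//; apply/ltW/(lt_le_trans (truncnS_gt _)).
    by rewrite ler_nat.
  by rewrite -[d.+1%:R]natr1; lra.
have [||n [nc nh]] := cover_of_code mu_gt0 mu_noninc eps0 d'1 _ _ cd'.
- by rewrite ler_peMl ?sqr_ge0// ltW.
- rewrite -mulrDl addrCA subrr addr0 -exprMn.
  by apply: lerXn2r; rewrite ?nnegrE ?(ltW eps0)// mulr_ge0// ltW.
exists n; split => //; apply: le_trans nh _; rewrite ler_expR.
have /andP[dz _] := fl_bounds d (ltW oz0).
apply: (@le_trans _ _ ((b + z) * ((1 + z) * d%:R))).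
  by rewrite ler_pM2l// addr_gt0.
by rewrite mulrA ler_wpM2r.
Qed.

(** Below, the volume comparison gives N >= exp (logsum d), because eps < mu d; above, the minimal
    cover is no larger than that of [exists_cover]. *)
Lemma entropy_bounds (eta : R) : 0 < eta -> eta < b -> exists D, forall d, (D <= d)%N ->
  forall eps, mu d.+1 <= eps -> eps < mu d ->
  (b - eta) / ln 2 * d%:R <= H eps <= (b + eta) / ln 2 * d%:R.
Proof.
move=> eta0 etab.
have [D0 HD0] := exists_cover eta0.
have e20 : 0 < eta / 2 by rewrite divr_gt0.
have [||C0 HC0] := @logsum_lower (b - eta / 2).
- by lra.
- by lra.
exists (maxn (maxn D0 1) (Num.truncn (C0 / (eta / 2))).+1) => d.
rewrite !geq_max => /andP[/andP[d0 d1] d2] eps h1 h2.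
have muS : 0 < mu d.+1 by exact: mu_gt0.
have mud : 0 < mu d by exact: mu_gt0.
have eps0 : 0 < eps by exact: lt_le_trans h1.
have [n [nc nh]] := HD0 d d0 eps h1.
have [cc cn] := covering_number_spec nc.
rewrite /metric_entropy; set N := covering_number _ _ in cc cn *.
have l2 : 0 < ln 2 :> R by rewrite ln_gt0// ltr1n.
have lo : expR (logsum d) <= N%:R.
  have -> : expR (logsum d) = \prod_(i < d) (mu i.+1 / mu d).
    rewrite /logsum expR_sum; apply: eq_bigr => i _.
    by rewrite lnK// posrE divr_gt0// mu_gt0.
  rewrite big_split/= prodr_const card_ord exprVn ler_pdivrMr ?exprn_gt0//.
  apply: le_trans (cover_lower_bound mu_gt0 d eps0 cc) _.
  by rewrite ler_wpM2l//; apply: lerXn2r; rewrite ?nnegrE ltW.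
have N0 : 0 < N%:R :> R by apply: lt_le_trans lo; exact: expR_gt0.
apply/andP; split; rewrite mulrAC ler_pM2r ?invr_gt0//.
  apply: (@le_trans _ _ (logsum d)).
    apply: le_trans (HC0 d d1).
    have : C0 <= d%:R * (eta / 2).
      rewrite -ler_pdivrMr//; apply/ltW/(lt_le_trans (truncnS_gt _)).
      by rewrite ler_nat.
    by lra.
  by rewrite -[leLHS]expRK ler_ln ?posrE ?expR_gt0.
rewrite -[leRHS]expRK ler_ln ?posrE ?expR_gt0//; apply: le_trans nh.
by rewrite ler_nat.
Qed.

(** [d] is the number of semi-axes larger than [eps], which exceeds any bound as [eps] tends to
    0. *)
Lemma exists_index (D : nat) (eps : R) : (1 <= D)%N -> 0 < eps -> eps < mu D ->
  exists2 d, (D <= d)%N & mu d.+1 <= eps /\ eps < mu d.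
Proof.
move=> D1 eps0 epsD.
have ex : exists n, mu n.+1 <= eps.
  have [[|n]// _ hn] := mu_cvg0 eps0.
  by exists n.
have [d hd dmin] := ex_minnP ex.
have Dd : (D <= d)%N.
  rewrite leqNgt; apply/negP => dD; move: epsD; rewrite ltNge => /negP; apply.
  by apply: le_trans hd; exact: mu_noninc.
exists d => //; split => //; rewrite ltNge; apply/negP => h.
have d1 : (0 < d)%N by exact: leq_trans Dd.
by have := dmin d.-1; rewrite prednK// => /(_ h); rewrite leqNgt prednK// leqnn.
Qed.

(** The index k in [phi] is about (b / ln 2) * d, so regular variation compares [mu k] with [mu d]
    and [mu d.+1], which enclose [eps]. *)
Lemma ratio_bounds (c1 c2 : R) : 0 < c1 -> c1 < b / ln 2 -> b / ln 2 < c2 ->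
  exists2 D, (1 <= D)%N & forall d, (D <= d)%N ->
  forall eps, mu d.+1 <= eps -> eps < mu d ->
  c1 `^ b <= eps / phi mu (H eps) <= c2 `^ b.
Proof.
move=> c10 c1c cc2.
have l2 : 0 < ln 2 :> R by rewrite ln_gt0// ltr1n.
have bc2 : b < c2 * ln 2 by rewrite -ltr_pdivrMr.
have bc1 : c1 * ln 2 < b by rewrite -ltr_pdivlMr.
have [eta [eta0 eta1 eta2]] : exists eta,
    [/\ 0 < eta, eta < c2 * ln 2 - b & eta < b - c1 * ln 2].
  exists (Num.min (c2 * ln 2 - b) (b - c1 * ln 2) / 2).
  have m0 : 0 < Num.min (c2 * ln 2 - b) (b - c1 * ln 2) by rewrite lt_min !subr_gt0 bc1 bc2.
  have m2 : Num.min (c2 * ln 2 - b) (b - c1 * ln 2) / 2 < Num.min (c2 * ln 2 - b) (b - c1 * ln 2).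
    by rewrite ltr_pdivrMr// ltr_pMr// ltr1n.
  by split; [rewrite divr_gt0|apply: lt_le_trans m2 _; rewrite ge_min lexx|
    apply: lt_le_trans m2 _; rewrite ge_min lexx orbT].
have etab : eta < b by apply: lt_trans eta2 _; rewrite gtrBl mulr_gt0.
have a2 : (b + eta) / ln 2 < c2 by rewrite ltr_pdivrMr// addrC -ltrBrDr.
have a1 : c1 < (b - eta) / ln 2 by rewrite ltr_pdivlMr// ltrBrDr addrC -ltrBrDr.
have [D0 HD0] := entropy_bounds eta0 etab.
move: a1 a2 HD0; set a1 := (b - eta) / ln 2; set a2 := (b + eta) / ln 2 => a1c a2c HD0.
have c20 : 0 < c2 by apply: lt_trans cc2; rewrite divr_gt0.
have a20 : 0 < a2 by rewrite divr_gt0// addr_gt0.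
(* The gaps between [g1], [g2] and [a1], [a2] absorb the integer part and the shift from d to d + 1;
   those to [c1], [c2] absorb the error in regular variation. *)
have [g1 cg1 ga1] : exists2 g1, c1 < g1 & g1 < a1 by exists ((c1 + a1) / 2); rewrite midf_lt.
have [g2 ag2 gc2] : exists2 g2, a2 < g2 & g2 < c2 by exists ((a2 + c2) / 2); rewrite midf_lt.
have g10 : 0 < g1 by exact: lt_trans cg1.
have g20 : 0 < g2 by exact: lt_trans ag2.
have pw x y : 0 < x -> x < y -> y `^ (- b) < x `^ (- b).
  move=> x0 xy; have y0 : 0 < y by exact: lt_trans xy.
  rewrite !powRN ltf_pV2 ?posrE ?powR_gt0//.
  by apply: gt0_ltr_powR => //; rewrite nnegrE ltW.
have [N1 HN1] := rv_upper g10 (pw _ _ c10 cg1).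
have [N2 HN2] := rv_lower g20 (pw _ _ g20 gc2).
have [N3 HN3] := fl_ge 1 g10.
exists (maxn (maxn (maxn D0 1) (maxn N1 N2)) (maxn N3 (maxn
  (Num.truncn (g1 / (a1 - g1))).+1 (Num.truncn (1 / (g2 - a2))).+1))).
  by rewrite !leq_max orbT.
move=> d; rewrite !geq_max => /andP[/andP[/andP[d0 d1] /andP[dN1 dN2]] /andP[dN3 /andP[d4 d5]]].
move=> eps h1 h2.
have muS : 0 < mu d.+1 by exact: mu_gt0.
have mud : 0 < mu d by exact: mu_gt0.
have eps0 : 0 < eps by exact: lt_le_trans h1.
have /andP[H1 H2] := HD0 d d0 eps h1 h2.
rewrite /phi; set k := (Num.truncn _).+1.
have muk : 0 < mu k by exact: mu_gt0.
have a10 : 0 < a1 by exact: lt_trans ga1.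
have H0 : 0 <= H eps by apply: le_trans H1; rewrite mulr_ge0// ltW.
have /andP[k1 k2] : k%:R - 1 <= H eps < k%:R.
  by have /andP[t1 t2] := truncn_itv H0; rewrite /k -natr1 addrK t1 natr1 t2.
apply/andP; split.
  rewrite ler_pdivlMr// mulrC -ler_pdivlMr ?powR_gt0// mulrC -powRN.
  apply: (@le_trans _ _ (c1 `^ (- b) * mu d.+1)); last by rewrite ler_pM2l// powR_gt0.
  apply: le_trans (HN1 d.+1 (leqW dN1)); apply: mu_noninc; first by apply: HN3; exact: leqW.
  rewrite -(ler_nat R); have /andP[t1 _] := fl_bounds d.+1 (ltW g10).
  apply: le_trans t1 _; apply: le_trans (ltW k2); apply: le_trans H1.
  have : g1 <= d%:R * (a1 - g1).
    rewrite -ler_pdivrMr ?subr_gt0//; apply/ltW/(lt_le_trans (truncnS_gt _)).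
    by rewrite ler_nat.
  by rewrite -[d.+1%:R]natr1; lra.
rewrite ler_pdivrMr// -ler_pdivrMl ?powR_gt0// -powRN.
apply: (@le_trans _ _ (c2 `^ (- b) * mu d)); first by rewrite ler_pM2l ?powR_gt0// ltW.
apply: le_trans (HN2 d dN2) _; apply: mu_noninc => //.
rewrite truncn_ge_nat ?(mulr_ge0 (ltW g20))//.
have : 1 <= d%:R * (g2 - a2).
  rewrite -ler_pdivrMr ?subr_gt0//; apply/ltW/(lt_le_trans (truncnS_gt _)).
  by rewrite ler_nat.
by lra.
Qed.

End RegularVariation.

Theorem theorem15 (R : realType) (b : R) (mu : nat -> R)
    (b_gt0 : 0 < b)
    (mu_gt0 : forall n : nat, (1 <= n)%N -> 0 < mu n)
    (mu_noninc : forall m n : nat, (1 <= m)%N -> (m <= n)%N -> mu n <= mu m)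
    (mu_rv : regularly_varying mu (- b)) :
  eps / phi mu (metric_entropy eps (ellipsoid2 mu)) @[eps --> 0^'+]
    --> (b / ln 2) `^ b.
Proof.
have l2 : 0 < ln 2 :> R by rewrite ln_gt0// ltr1n.
have c0 : 0 < b / ln 2 by rewrite divr_gt0.
set c := b / ln 2 in c0 *.
have cb0 : 0 < c `^ b by exact: powR_gt0.
apply/cvgrPdist_lt => e e0.
(* Besides e' < e, this keeps c ^ b - e' positive, so that it has a b-th root. *)
pose e' := Num.min e (c `^ b) / 2.
have e'0 : 0 < e' by rewrite divr_gt0// lt_min e0.
have e'e : e' < e.
  by rewrite ltr_pdivrMr// gt_min ltr_pMr ?ltr1n.
have e'c : e' < c `^ b.
  by rewrite ltr_pdivrMr// gt_min; apply/orP; right; rewrite ltr_pMr ?ltr1n.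
have rootK x : 0 < x -> (x `^ b^-1) `^ b = x.
  by move=> x0; rewrite -powRrM mulVf ?gt_eqF// powRr1// ltW.
have root_lt x y : 0 < x -> x < y -> x `^ b^-1 < y `^ b^-1.
  move=> x0 xy; have y0 : 0 < y by exact: lt_trans xy.
  by apply: gt0_ltr_powR => //; rewrite ?invr_gt0// nnegrE ltW.
have cK : (c `^ b) `^ b^-1 = c by rewrite -powRrM mulfV ?gt_eqF// powRr1// ltW.
have x10 : 0 < c `^ b - e' by rewrite subr_gt0.
have x20 : 0 < c `^ b + e' by rewrite addr_gt0.
(* The b-th roots turn the bounds [c1 ^ b] and [c2 ^ b] of [ratio_bounds] into c ^ b - e' and c ^ b
   + e'. *)
have [|||D D1 HD] := @ratio_bounds _ b mu b_gt0 mu_gt0 mu_noninc mu_rv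
  ((c `^ b - e') `^ b^-1) ((c `^ b + e') `^ b^-1).
- exact: powR_gt0.
- by rewrite -/c -[ltRHS]cK; apply: root_lt => //; rewrite gtrBl.
- by rewrite -/c -[ltLHS]cK; apply: root_lt => //; rewrite ltrDl.
near=> eps.
have [d Dd [h1 h2]] : exists2 d, (D <= d)%N & mu d.+1 <= eps /\ eps < mu d.
  apply: (exists_index b_gt0 mu_gt0 mu_noninc mu_rv) => //.
  near: eps; apply: nbhs_right_lt; exact: mu_gt0.
have := HD d Dd eps h1 h2; rewrite !rootK// => /andP[t1 t2].
apply: le_lt_trans e'e; rewrite ler_distl; apply/andP; split; lra.
Unshelve. all: by end_near.
Qed.
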